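(* Consider the wall process $(W_n)_{n\ge 0}$ on $\mathbb{Z}^d$, with $\mu_n=\mathbb{E}\,W_n(0)$, driven by integrable symmetric i.i.d. noise. Then: (a) there is no nondegenerate invariant measure for the wall process $(W_n)$; (b) $W_n\to\infty$ in probability, i.e. for every $i\in\mathbb{Z}^d$ and every $M>0$, $\mathbb{P}(W_n(i)>M)\to 1$ as $n\to\infty$; (c) $\mu_n\to\infty$ as $n\to\infty$; (d) $\mu_n/n\to 0$ as $n\to\infty$.
   Context: Fix $d\ge 1$ and $p:\mathbb{Z}^d\to[0,1]$ with $\sum_j p(j)=1$, $\sum_j j\,p(j)=0$, $p(j)=0$ whenever $|j|>v$ for some finite $v$, and such that $\{j\in\mathbb{Z}^d: p(j)\ne 0\}$ generates $\mathbb{Z}^d$. Put $p(i,j)=p(j-i)$ and, for a function $f$ on $\mathbb{Z}^d$, $(\mathcal{P}f)(i)=\sum_{j\in\mathbb{Z}^d}p(i,j)f(j)$. Let $\varepsilon$ and $\varepsilon_n(i)$ ($n\in\mathbb{Z}$, $i\in\mathbb{Z}^d$) be i.i.d. integrable symmetric real random variables (symmetric: $\varepsilon$ and $-\varepsilon$ have the same law), and $\varepsilon_n=(\varepsilon_n(i))_{i\in\mathbb{Z}^d}$. With $a^+=\max(a,0)$ (applied coordinatewise), the wall process is $W_0(i)=0$ for all $i$ and $W_n=(\mathcal{P}W_{n-1}+\varepsilon_n)^+$ for $n\ge 1$. Set $\mu_n=\mathbb{E}\,W_n(0)$. The law of a random surface $Z=(Z(i))_{i\in\mathbb{Z}^d}$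 is an invariant measure for the wall process if $Z$ has the same law as $(\varepsilon_0+\mathcal{P}Z)^+$, with $\varepsilon_0$ and $Z$ independent. It is nondegenerate if it gives no weight to infinity, i.e. it is a probability measure on $[0,\infty)^{\mathbb{Z}^d}$.
   Formalization: The noise is additionally assumed not to be almost surely zero; if ε = 0 almost surely, then W_n = 0 for all n and the point mass at 0 is invariant, so (a), (b) and (c) fail. *)

(* Defs.v *)
From HB Require Import structures.
From mathcomp Require Import all_boot all_order all_algebra.
From mathcomp Require Import all_classical all_reals all_analysis.

Set Implicit Arguments.
Unset Strict Implicit.
Unset Printing Implicit Defensive.

Import Order.TTheory GRing.Theory Num.Theory.
Import numFieldNormedType.Exports.

Local Open Scope classical_set_scope.
Local Open Scope ring_scope.

Notation Zd d := 'rV[int]_d.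

(* Sums over Z^d use \sum_(j \in setT), which is the sum over the support of
   the summand when that support is finite. It is finite wherever it is used
   below, because finite_range bounds the support of p.
   mx_norm is the sup norm; finite_range does not depend on the norm. *)
Record jump_law (R : realType) (d : nat) (p : Zd d -> R) : Prop := JumpLaw {
  jump_prob : forall j, 0 <= p j <= 1;
  finite_range : exists v : int, forall j, v < mx_norm j -> p j = 0;
  jump_total : \sum_(j \in [set: Zd d]) p j = 1;
  jump_centered :
    \sum_(j \in [set: Zd d]) p j *: map_mx (intr : int -> R) j = 0;
  jump_generates : forall G : set (Zd d),
    G 0 -> (forall x y, G x -> G y -> G (x - y)) ->
    (forall j, p j != 0 -> G j) -> G = setT }.

(* Generators of the product sigma-algebra on R^(Z^d). *)
Definition coord_cylinders (R : realType) (d : nat) : set (set (Zd d -> R)) :=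
  [set C | exists i (B : set R), measurable B /\ C = [set z | B (z i)]].

Definition surface (R : realType) (d : nat) :=
  g_sigma_algebraType (@coord_cylinders R d).

HB.instance Definition _ (R : realType) (d : nat) :=
  Measurable.on (surface R d).

Definition averaging (R : realType) (d : nat) (p : Zd d -> R)
    (f : Zd d -> R) : Zd d -> R :=
  fun i => \sum_(j \in [set: Zd d]) p (j - i) * f j.

Definition wall_step (R : realType) (d : nat) (p : Zd d -> R)
    (w e : Zd d -> R) : Zd d -> R :=
  fun i => Num.max (averaging p w i + e i) 0.

Fixpoint wall (R : realType) (d : nat) (p : Zd d -> R)
    (e : int -> Zd d -> R) (n : nat) : Zd d -> R :=
  if n is m.+1 then wall_step p (wall p e m) (e m.+1%:Z) else fun=> 0.

Definition mutually_independent (disp : measure_display)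
    (T : measurableType disp) (R : realType) (P : probability T R)
    (I : choiceType) (X : I -> {RV P >-> R}) : Prop :=
  forall (s : seq I) (B : I -> set R), uniq s ->
    (forall i, measurable (B i)) ->
    P (\bigcap_(i in [set` s]) X i @^-1` B i) =
    (\prod_(i <- s) P (X i @^-1` B i))%E.

Record iid_symmetric_noise (disp : measure_display) (T : measurableType disp)
    (R : realType) (P : probability T R) (d : nat)
    (eps : int -> Zd d -> {RV P >-> R}) : Prop := IidSymmetricNoise {
  noise_independent :
    mutually_independent (fun a : int * Zd d => eps a.1 a.2);
  noise_identical : forall n i m j (B : set R), measurable B ->
    P (eps n i @^-1` B) = P (eps m j @^-1` B);
  noise_integrable : forall n i, P.-integrable setT (EFin \o eps n i);
  noise_symmetric : forall n i (B : set R), measurable B ->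
    P (eps n i @^-1` B) = P [set t | B (- eps n i t)] }.

Section wall_process.
Variables (disp : measure_display) (T : measurableType disp) (R : realType).
Variables (P : probability T R) (d : nat) (p : Zd d -> R).
Variable eps : int -> Zd d -> {RV P >-> R}.

Definition wall_process (n : nat) (i : Zd d) (t : T) : R :=
  wall p (fun m j => eps m j t) n i.

Definition wall_mean (n : nat) : \bar R := ('E_P[wall_process n 0])%E.

(* nu is the law of a random surface Z which has the law of (e + PZ)^+, where
   e is independent of Z and has the law of eps 0. The pair (e, Z) may live on
   any probability space, not necessarily on T. *)
Definition wall_invariant (nu : probability (surface R d) R) : Prop :=
  exists (disp' : measure_display) (T' : measurableType disp')
    (Q : probability T' R) (e Z : {RV Q >-> surface R d}),
  [/\ forall A : set (surface R d), measurable A ->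
        Q (e @^-1` A) = P [set t | A (fun i => eps 0 i t)],
      forall A B : set (surface R d), measurable A -> measurable B ->
        Q (e @^-1` A `&` Z @^-1` B) = (Q (e @^-1` A) * Q (Z @^-1` B))%E,
      forall A : set (surface R d), measurable A -> nu A = Q (Z @^-1` A) &
      forall A : set (surface R d), measurable A ->
        nu A = Q [set t | A (wall_step p (Z t) (e t))]].

End wall_process.

Definition nondegenerate_law (R : realType) (d : nat)
    (nu : probability (surface R d) R) : Prop :=
  nu [set z : surface R d | forall i, 0 <= z i] = 1%E.

(* Main.v *)
(* Let r_n(i) = (P W_n + eps_{n+1})^-(i) be the reflection at the wall, so that
   W_{n+1} = P W_n + eps_{n+1} + r_n and E W_{n+1}(0) = E W_n(0) + E r_n(0).
   1. E r_n(0) is nonincreasing in n, because the reflection cost is an antitone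
      function of the surface and W_n grows stochastically.
   2. E W_n(0) = o(n): for the convex potential sqrt(L^2 + x^2), one step costs
      on average at most E min(|eps|, eps^2/(2L)), by symmetry of eps, and this
      is small for large L. With 1, E r_n(0) --> 0.
   3. If P(eps <= -a) > 0, then for every m and c < a m, P^m W_n(0) <= c has
      vanishing probability: otherwise, independently of W_n, the next m layers
      of noise push the surface down by a m and force a reflection.
   4. W_{n+m} >= P^m W_n + W' - V, where W' is the wall process driven by the
      noise after time n and V the total displacement due to its reflections,
      with E V(0) = E W'_m(0) = o(m). Taking m large gives divergence in
      probability; the other claims follow by Markov's inequality and by
      comparing an invariant surface with the process started from 0. *)

Require Import Defs.
From HB Require Import structures.
From mathcomp Require Import all_boot all_order all_algebra.
From mathcomp Require Import all_classical all_reals all_analysis.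
From mathcomp Require Import measurable_realfun ring lra.

Set Implicit Arguments.
Unset Strict Implicit.
Unset Printing Implicit Defensive.

Import Order.TTheory GRing.Theory Num.Theory.
Import numFieldNormedType.Exports.

Local Open Scope classical_set_scope.
Local Open Scope ring_scope.

(** * Averaging *)

(** Every coordinate of a jump in the support lies in [[-V, V]]. Shifting by [V] encodes it as an
    ordinal below [2V + 1], so the support lies in the image of a finite function type. *)
Lemma jump_finite_support (R : realType) (d : nat) (p : Zd d -> R) :
  jump_law p -> finite_set [set k | p k != 0].
Proof.
move=> pJ; have [v vP] := finite_range pJ.
pose V := `|v|%N.
pose row_of (f : {ffun 'I_d -> 'I_(V + V).+1}) : Zd d :=
  \row_i ((f i : nat)%:Z - V%:Z).
apply: (@sub_finite_set _ _ (row_of @` setT)); last first.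
  exact/finite_image/finite_finset.
move=> j /= pj.
have jv i : `|j 0 i| <= v.
  have : mx_norm j <= v by rewrite leNgt; apply: contra pj => /vP ->.
  apply: le_trans; rewrite mx_normrE.
  exact: (le_bigmax _ (fun ij : 'I_1 * 'I_d => `|j ij.1 ij.2|) (0, i)).
exists [ffun i => inord (absz (j 0 i + V%:Z))] => //.
apply/rowP => i; rewrite !mxE ffunE.
have /ler_normlP[jv1 jv2] := jv i.
have v0 : (V : int) = v by rewrite /V gez0_abs //; exact: le_trans (jv i).
have jV : 0 <= j 0 i + V by rewrite v0 addrC -lerBlDr sub0r.
rewrite inordK; first by rewrite gez0_abs // addrK.
by rewrite ltnS -lez_nat gez0_abs // PoszD lerD2r v0.
Qed.

(** A sequence turns sums over the lattice into ordinary iterated sums, to which linearity and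
    monotonicity lemmas apply. *)
Definition jump_support (R : realType) (d : nat) (p : Zd d -> R) :=
  finmap.enum_fset (fset_set [set k | p k != 0]).

Section averaging_theory.
Variables (R : realType) (d : nat) (p : Zd d -> R).
Hypothesis p_jump : jump_law p.
Implicit Types (f g : Zd d -> R) (i a : Zd d).

Lemma jump_ge0 k : 0 <= p k.
Proof. by have /andP[] := jump_prob p_jump k. Qed.

Lemma jump_support_total : \sum_(k <- jump_support p) p k = 1.
Proof.
rewrite -(jump_total p_jump) -fsbig_finite; last exact: jump_finite_support.
apply: fsbig_widen => // k [_ /= /negP]; rewrite negbK => /eqP //.
Qed.

(** Substituting [j = i + k] makes the range of summation independent of the site. *)
Lemma averagingE f i :
  averaging p f i = \sum_(k <- jump_support p) p k * f (i + k).
Proof.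
rewrite /averaging (reindex_fsbigT (fun k => i + k)); last first.
  by exists (fun k => k - i) => k; rewrite addrC ?addKr ?subrK.
rewrite -fsbig_finite; last exact: jump_finite_support.
under eq_fsbigr do rewrite (addrC i) addrK (addrC _ i).
apply/esym/fsbig_widen => // k [_ /= /negP]; rewrite negbK => /eqP ->.
by rewrite mul0r.
Qed.

Lemma averaging_shift f a i :
  averaging p (fun j => f (a + j)) i = averaging p f (a + i).
Proof. by rewrite !averagingE; apply: eq_bigr => k _; rewrite addrA. Qed.

Lemma le_averaging f g i :
  (forall j, f j <= g j) -> averaging p f i <= averaging p g i.
Proof.
move=> fg; rewrite !averagingE; apply: ler_sum => k _.
by rewrite ler_wpM2l // jump_ge0.
Qed.

Lemma averaging_cst (c : R) i : averaging p (fun=> c) i = c.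
Proof. by rewrite averagingE -mulr_suml jump_support_total mul1r. Qed.

Lemma averaging_ge0 f i : (forall j, 0 <= f j) -> 0 <= averaging p f i.
Proof. by move=> f0; rewrite -(averaging_cst 0 i); exact: le_averaging. Qed.

Lemma averagingD f g i :
  averaging p (fun j => f j + g j) i = averaging p f i + averaging p g i.
Proof.
rewrite !averagingE -big_split; apply: eq_bigr => k _ /=.
by rewrite mulrDr.
Qed.

Lemma averagingB f g i :
  averaging p (fun j => f j - g j) i = averaging p f i - averaging p g i.
Proof.
rewrite !averagingE -sumrB; apply: eq_bigr => k _ /=.
by rewrite mulrBr.
Qed.

End averaging_theory.

(** * Measurability and independence *)

Section surface_measurability.
Variables (R : realType) (d : nat).

Lemma measurable_coordinate (i : Zd d) :
  measurable_fun [set: surface R d] (fun z : surface R d => (z : Zd d -> R) i).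
Proof.
move=> _ B mB; rewrite setTI; apply: sub_sigma_algebra.
by exists i, B.
Qed.

Lemma measurable_to_surface (disp : measure_display) (T : measurableType disp)
    (X : T -> surface R d) :
  (forall i, measurable_fun [set: T] (fun t => (X t : Zd d -> R) i)) ->
  measurable_fun [set: T] X.
Proof.
move=> mX; apply: (@measurability _ _ T (surface R d) setT X (@coord_cylinders R d)).
  by [].
by move=> _ [_ [i [B [mB ->]] <-]]; exact: mX.
Qed.

Variable p : Zd d -> R.
Hypothesis p_jump : jump_law p.

Lemma measurable_averaging (disp : measure_display) (T : measurableType disp)
    (X : T -> Zd d -> R) i :
  (forall j, measurable_fun [set: T] (fun t => X t j)) ->
  measurable_fun [set: T] (fun t => averaging p (X t) i).
Proof.
move=> mX; under eq_fun do rewrite (averagingE p_jump).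
apply: measurable_sum => k; apply: measurable_funM => //; exact: mX.
Qed.

Lemma measurable_wall_step (disp : measure_display) (T : measurableType disp)
    (X Y : T -> Zd d -> R) i :
  (forall j, measurable_fun [set: T] (fun t => X t j)) ->
  (forall j, measurable_fun [set: T] (fun t => Y t j)) ->
  measurable_fun [set: T] (fun t => wall_step p (X t) (Y t) i).
Proof.
move=> mX mY; apply: measurable_maxr => //.
by apply: measurable_funD => //; exact: measurable_averaging.
Qed.

(** Only the noise at times [1] to [n] has to be measurable. Applied with the sigma-algebra
    generated by the past noise on [T], this says that the wall is adapted. *)
Lemma measurable_wall (disp : measure_display) (T : measurableType disp)
    (e : int -> Zd d -> T -> R) n i :
  (forall m j, (m < n)%N -> measurable_fun [set: T] (e m.+1%:Z j)) ->
  measurable_fun [set: T] (fun t => wall p (fun m j => e m j t) n i).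
Proof.
elim: n i => [//|n IH] i me /=; apply: measurable_wall_step => j.
  by apply: IH => m k mn; apply: me; exact: ltnW.
exact: me.
Qed.

End surface_measurability.

(** * Independence of disjoint blocks of random variables *)

Section independence.
Variables (disp : measure_display) (T : measurableType disp) (R : realType).
Variable P : probability T R.

(** Both sides are finite measures in [A] that agree on the pi-system [G], which contains the whole
    space; hence they agree on the sigma-algebra it generates. *)
Lemma probability_indep_generated (G : set (set T)) (C : set T) :
  G `<=` measurable -> setI_closed G -> G setT -> measurable C ->
  (forall A, G A -> P (A `&` C) = (P A * P C)%E) ->
  forall A, <<s G >> A -> P (A `&` C) = (P A * P C)%E.
Proof.
move=> Gm GI GT mC GP A GA.
have PC0 : 0 <= fine (P C) by exact: fine_ge0.
have PCE : (fine (P C))%:E = P C by rewrite fineK // fin_num_measure.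
have mscaleE B : mscale (NngNum PC0) P B = (P B * P C)%E.
  by rewrite [RHS]muleC -[in RHS]PCE.
have eqm : mrestr P mC A = mscale (NngNum PC0) P A.
  apply: (@g_sigma_algebra_measure_unique _ R _ G Gm (fun=> setT)) GA => //.
  - by rewrite bigcup_const.
  - by move=> B GB; exact: etrans (GP _ GB) (esym (mscaleE B)).
  - move=> _; rewrite /= /mrestr setTI ltey_eq fin_num_measure //.
exact: etrans eqm (mscaleE A).
Qed.

Variables (I : choiceType) (X : I -> {RV P >-> R}).

(** A pi-system generating the sigma-algebra of the variables with index in [D]. *)
Definition cylinders (D : set I) : set (set T) :=
  [set C | exists (s : seq I) (B : I -> set R), [/\ forall i, i \in s -> D i,
     forall i, measurable (B i) & C = \bigcap_(i in [set` s]) X i @^-1` B i]].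

Lemma measurable_cylinders D : cylinders D `<=` measurable.
Proof.
move=> _ [s [B [_ mB ->]]]; apply: fin_bigcap_measurable => //.
by move=> i _; rewrite -[X in measurable X]setTI; exact: measurable_funPT.
Qed.

Lemma cylinders_setT D : cylinders D setT.
Proof.
by exists [::], (fun=> setT); split => //; rewrite set_nil bigcap_set0.
Qed.

Lemma cylinder_preimage D i (B : set R) :
  D i -> measurable B -> cylinders D (X i @^-1` B).
Proof.
move=> Di mB; exists [:: i], (fun=> B); split => //.
  by move=> j; rewrite inE => /eqP ->.
by rewrite set_cons1 bigcap_set1.
Qed.

(** Merges two lists of constraints into one family of sets; an index absent from a list is
    unconstrained by it, whence the default [setT]. *)
Let glue (s1 s2 : seq I) (B1 B2 : I -> set R) i : set R :=
  (if i \in s1 then B1 i else setT) `&` (if i \in s2 then B2 i else setT).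

Let measurable_glue s1 s2 B1 B2 : (forall i, measurable (B1 i)) ->
  (forall i, measurable (B2 i)) -> forall i, measurable (glue s1 s2 B1 B2 i).
Proof. by move=> mB1 mB2 i; apply: measurableI; case: ifP. Qed.

Let bigcap_glue s1 s2 B1 B2 (s : seq I) : s =i s1 ++ s2 ->
  \bigcap_(i in [set` s]) X i @^-1` (glue s1 s2 B1 B2 i) =
  (\bigcap_(i in [set` s1]) X i @^-1` B1 i) `&`
  (\bigcap_(i in [set` s2]) X i @^-1` B2 i).
Proof.
move=> sE; rewrite /glue; apply/seteqP; split=> [t tG|t [t1 t2] i _] /=.
  split=> i /= si; by have /= := tG i; rewrite sE mem_cat si ?orbT => /(_ isT) [].
by split; case: ifP => // si; [exact: t1|exact: t2].
Qed.

Lemma cylinders_setI D : setI_closed (cylinders D).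
Proof.
move=> _ _ [s1 [B1 [D1 mB1 ->]]] [s2 [B2 [D2 mB2 ->]]].
exists (s1 ++ s2), (glue s1 s2 B1 B2); split; last by rewrite bigcap_glue.
  by move=> i; rewrite mem_cat => /orP[/D1|/D2].
exact: measurable_glue.
Qed.

Hypothesis X_indep : mutually_independent X.

(** Since the blocks are disjoint, concatenating the lists after removal of duplicates gives a
    duplicate-free list. The product formula for this list splits into the two factors. *)
Lemma probability_cylinders_disjoint (D1 D2 : set I) A C :
  D1 `&` D2 = set0 -> cylinders D1 A -> cylinders D2 C ->
  P (A `&` C) = (P A * P C)%E.
Proof.
move=> D12 [s1 [B1 [sD1 mB1 ->]]] [s2 [B2 [sD2 mB2 ->]]].
have undupE (s : seq I) B : \bigcap_(i in [set` s]) X i @^-1` B i =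
    \bigcap_(i in [set` undup s]) X i @^-1` B i.
  congr (\bigcap_(i in _) _).
  by apply/seteqP; split=> i /=; rewrite mem_undup.
have disj i : i \in s1 -> i \in s2 -> False.
  move=> /sD1 i1 /sD2 i2; suff : set0 i by [].
  by rewrite -D12.
rewrite -(@bigcap_glue _ _ _ _ (undup s1 ++ undup s2)); last first.
  by move=> i; rewrite !mem_cat !mem_undup.
rewrite X_indep; last 2 first.
- rewrite cat_uniq !undup_uniq andbT /=; apply/hasPn => i.
  by rewrite !mem_undup => i2; apply/negP => i1; exact: disj i1 i2.
- exact: measurable_glue.
rewrite (undupE s1) (undupE s2) !X_indep ?undup_uniq // big_cat /=.
rewrite !big_seq; congr (_ * _)%E; apply: eq_bigr => i; rewrite mem_undup => si;
  congr (P (_ @^-1` _)); rewrite /glue si.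
  by case: ifP => [/(disj i si)//|_]; rewrite setIT.
by case: ifP => [/disj/(_ si)//|_]; rewrite setTI.
Qed.

(** The pi-system argument is used twice: first to pass from cylinders to general [A] with [C]
    fixed, then in the same way for [C] with [A] a cylinder. *)
Lemma probability_blocks_indep (D1 D2 : set I) A C : D1 `&` D2 = set0 ->
  <<s cylinders D1 >> A -> <<s cylinders D2 >> C ->
  P (A `&` C) = (P A * P C)%E.
Proof.
move=> D12 mA mC.
have sub (D : set I) : <<s cylinders D >> `<=` measurable.
  apply: smallest_sub; first exact: sigma_algebra_measurable.
  exact: measurable_cylinders.
apply: (probability_indep_generated (G := cylinders D1)) => //.
- exact: measurable_cylinders.
- exact: cylinders_setI.
- exact: cylinders_setT.
- exact: sub mC.
move=> {}A {}mA; rewrite setIC muleC.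
apply: (probability_indep_generated (G := cylinders D2)) => //.
- exact: measurable_cylinders.
- exact: cylinders_setI.
- exact: cylinders_setT.
- exact: measurable_cylinders mA.
by move=> {}C {}mC; rewrite setIC muleC; exact: probability_cylinders_disjoint D12 mA mC.
Qed.

End independence.

(** * Laws of random surfaces *)

Section pair_law.
Variables (d0 d1 d2 : measure_display) (T : measurableType d0).
Variables (T1 : measurableType d1) (T2 : measurableType d2) (R : realType).
Variables (P : probability T R) (Q : probability T2 R).

(** By independence the law of the pair is the product of the law of [X] with [Q]; Tonelli's theorem
    then integrates out [Y] first. *)
Lemma ge0_integral_indep_pair (X : T -> T1) (Y : T -> T2)
    (phi : T1 * T2 -> \bar R) :
  measurable_fun setT X -> measurable_fun setT Y ->
  (forall A B, measurable A -> measurable B ->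
    P (X @^-1` A `&` Y @^-1` B) = (P (X @^-1` A) * P (Y @^-1` B))%E) ->
  (forall B, measurable B -> P (Y @^-1` B) = Q B) ->
  measurable_fun setT phi -> (forall z, (0 <= phi z)%E) ->
  (\int[P]_t phi (X t, Y t) = \int[P]_t \int[Q]_y phi (X t, y))%E.
Proof.
move=> mX mY XY YQ mphi phi0.
pose X' : {mfun T >-> T1} := HB.pack X (isMeasurableFun.Build _ _ _ _ X mX).
pose XY' : {mfun T >-> (T1 * T2)%type} := HB.pack (fun t => (X t, Y t))
  (isMeasurableFun.Build _ _ _ _ (fun t => (X t, Y t)) (measurable_fun_pair mX mY)).
transitivity (\int[distribution P XY']_z phi z)%E.
  by rewrite ge0_integral_distribution.
transitivity (\int[distribution P X' \x Q]_z phi z)%E.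
  apply: eq_measure_integral => A mA _; apply/esym.
  apply: product_measure_unique => // B C mB mC.
  transitivity (P (X @^-1` B) * P (Y @^-1` C))%E; first by rewrite -XY.
  by rewrite YQ.
rewrite fubini_tonelli1 // ge0_integral_distribution //.
  exact: measurable_fun_fubini_tonelli_F.
by move=> x; apply: integral_ge0 => y _.
Qed.

End pair_law.

Section surface_law.
Variables (R : realType) (d : nat).

Definition coordinate (i : Zd d) (z : surface R d) : R := (z : Zd d -> R) i.

HB.instance Definition _ i :=
  isMeasurableFun.Build _ _ _ _ (coordinate i) (@measurable_coordinate R d i).

(** Finite-dimensional cylinders form a pi-system that generates the product sigma-algebra. *)
Lemma surface_law_unique (m1 m2 : probability (surface R d) R) :
  (forall (s : seq (Zd d)) (B : Zd d -> set R), uniq s ->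
    (forall i, measurable (B i)) ->
    m1 (\bigcap_(i in [set` s]) coordinate i @^-1` B i) =
    m2 (\bigcap_(i in [set` s]) coordinate i @^-1` B i)) ->
  forall A, measurable A -> m1 A = m2 A.
Proof.
move=> m12 A mA.
(* Viewing coordinates as random variables on surface space makes the facts on [cylinders] available
   here. *)
pose X i : {RV m1 >-> R} := coordinate i.
apply: (@g_sigma_algebra_measure_unique _ R _ (cylinders X setT) _ (fun=> setT)).
- exact: measurable_cylinders.
- by move=> _; exact: cylinders_setT.
- by rewrite bigcup_const.
- exact: cylinders_setI.
- move=> _ [s [B [_ mB ->]]]; rewrite (_ : [set` s] = [set` undup s]).
    by apply: m12 => //; exact: undup_uniq.
  by apply/seteqP; split=> i /=; rewrite mem_undup.
- by move=> _; rewrite ltey_eq fin_num_measure.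
apply: sub_sigma_algebra2 mA => _ [i [B [mB ->]]].
exact: (@cylinder_preimage _ _ _ m1 _ X).
Qed.

End surface_law.

(** * The common law of the noise layers *)

Section noise.
Variables (disp : measure_display) (T : measurableType disp) (R : realType).
Variables (P : probability T R) (d : nat) (eps : int -> Zd d -> {RV P >-> R}).

(** The layer seen from site [a]: the translation is what later yields stationarity of the wall in
    space. *)
Definition noise_field (k : int) (a : Zd d) (t : T) : surface R d :=
  fun i => eps k (a + i) t.

Lemma measurable_noise_field k a : measurable_fun setT (noise_field k a).
Proof. by apply: measurable_to_surface => i; exact: measurable_funPT. Qed.

HB.instance Definition _ k a :=
  isMeasurableFun.Build _ _ _ _ (noise_field k a) (measurable_noise_field k a).

Definition noise_law := distribution P (noise_field 0 0).

Hypothesis eps_noise : iid_symmetric_noise eps.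

(** The right-hand side involves neither [k] nor [a], so all translated layers have the same
    finite-dimensional laws, hence the same law. *)
Lemma noise_field_cylinder k a (s : seq (Zd d)) (B : Zd d -> set R) :
  uniq s -> (forall i, measurable (B i)) ->
  P (noise_field k a @^-1` (\bigcap_(i in [set` s]) coordinate i @^-1` B i)) =
  (\prod_(i <- s) P (eps 0 0 @^-1` B i))%E.
Proof.
move=> us mB; have := noise_independent eps_noise
  (s := [seq (k, a + i) | i <- s]) (B := fun b => B (b.2 - a)).
rewrite map_inj_uniq => [|i j [/addrI]//].
move=> /(_ us (fun b => mB _)); rewrite big_map /=.
under eq_bigr do rewrite addrAC subrr add0r (noise_identical eps_noise _ _ 0 0)//.
move=> <-; congr (P _); apply/seteqP; split=> t tB i /=.
  by move=> /mapP[j sj ->] /=; rewrite addrAC subrr add0r; exact: tB.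
move=> si; have := tB (k, a + i).
rewrite /= addrAC subrr add0r; apply.
by apply/mapP; exists i.
Qed.

Lemma noise_fieldE k a (A : set (surface R d)) : measurable A ->
  P (noise_field k a @^-1` A) = noise_law A.
Proof.
apply: (@surface_law_unique R d (distribution P (noise_field k a)) noise_law).
move=> s B us mB; apply: etrans (noise_field_cylinder k a us mB) _.
exact/esym/noise_field_cylinder.
Qed.

Lemma ge0_integral_noise_site k i j (f : R -> \bar R) :
  measurable_fun setT f -> (forall x, 0 <= f x)%E ->
  (\int[noise_law]_z f ((z : Zd d -> R) i) = \int[P]_t f (eps k j t))%E.
Proof.
move=> mf f0; rewrite ge0_integral_distribution //; last first.
  by apply: measurableT_comp => //; exact: measurable_coordinate.
rewrite -(@ge0_integral_distribution _ _ _ _ _ P (eps 0 (0 + i)) f) //.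
rewrite -(@ge0_integral_distribution _ _ _ _ _ P (eps k j) f) //.
apply: eq_measure_integral => A mA _.
exact: noise_identical eps_noise _ _ _ _ _ mA.
Qed.

Lemma ge0_integral_noise_sym k i (f : R -> \bar R) :
  measurable_fun setT f -> (forall x, 0 <= f x)%E ->
  (\int[P]_t f (- eps k i t)%R = \int[P]_t f (eps k i t))%E.
Proof.
move=> mf f0.
have mN : measurable_fun setT (fun x : R => f (- x)).
  by apply: measurableT_comp => //; exact: measurable_oppr.
have mNe : measurable_fun setT (fun t => - eps k i t).
  by apply: measurable_funN; exact: measurable_funPT.
pose e' : {mfun T >-> R} :=
  HB.pack (fun t => - eps k i t) (isMeasurableFun.Build _ _ _ _ _ mNe).
rewrite -(@ge0_integral_distribution _ _ _ _ _ P (e') f) //.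
rewrite -(@ge0_integral_distribution _ _ _ _ _ P (eps k i) f) //.
apply: eq_measure_integral => A mA _.
exact/esym/(noise_symmetric eps_noise _ _ mA).
Qed.

End noise.

(** * The Markov kernel of the wall process *)

Section wall_law.
Variables (disp : measure_display) (T : measurableType disp) (R : realType).
Variables (P : probability T R) (d : nat) (p : Zd d -> R).
Variable eps : int -> Zd d -> {RV P >-> R}.

(* The wall process driven by the noise after time s; statements about it are
   made uniformly in s. *)
Definition wall_from (s : int) (n : nat) (i : Zd d) (t : T) : R :=
  wall p (fun m j => eps (s + m) j t) n i.

Definition wall_field (s : int) (n : nat) (a : Zd d) (t : T) : surface R d :=
  fun i => wall_from s n (a + i) t.

(** The one-step transition operator of the wall process, viewed as a Markov chain on surfaces. *)
Definition wall_kernel (f : surface R d -> \bar R) (w : surface R d) : \bar R :=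
  (\int[noise_law eps]_e f (wall_step p w e : surface R d))%E.

Hypothesis p_jump : jump_law p.
Hypothesis eps_noise : iid_symmetric_noise eps.

Lemma wall_fromS s n i t : wall_from s n.+1 i t =
  Num.max (averaging p (fun j => wall_from s n j t) i + eps (s + n.+1%:Z) i t) 0.
Proof. by []. Qed.

Lemma wall_from_ge0 s n i t : 0 <= wall_from s n i t.
Proof. by case: n => [//|n]; rewrite wall_fromS le_max lexx orbT. Qed.

Lemma wall_fieldS s n a t : wall_field s n.+1 a t =
  wall_step p (wall_field s n a t) (noise_field eps (s + n.+1%:Z) a t).
Proof.
apply/funext => i; rewrite /wall_field wall_fromS /wall_step.
by rewrite (averaging_shift p_jump (fun j => wall_from s n j t)).
Qed.

Lemma measurable_wall_from s n i : measurable_fun setT (wall_from s n i).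
Proof. by apply: measurable_wall => // m j _; exact: measurable_funPT. Qed.

Lemma measurable_wall_field s n a : measurable_fun setT (wall_field s n a).
Proof. by apply: measurable_to_surface => i; exact: measurable_wall_from. Qed.

(** The wall after [n] steps is a function of the noise up to time [s + n], and the next layer lies
    in a disjoint block of indices. *)
Lemma wall_noise_indep s n a (A B : set (surface R d)) :
  measurable A -> measurable B ->
  P (wall_field s n a @^-1` A `&` noise_field eps (s + n.+1%:Z) a @^-1` B) =
  (P (wall_field s n a @^-1` A) *
   P (noise_field eps (s + n.+1%:Z) a @^-1` B))%E.
Proof.
move=> mA mB.
pose X (b : int * Zd d) := eps b.1 b.2.
pose past : set (int * Zd d) := [set b | b.1 <= s + n%:Z].
pose next : set (int * Zd d) := [set b | b.1 = s + n.+1%:Z].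
(* Here [T] carries the smaller sigma-algebra of the block [D], so measurability expresses
   dependence on that block alone. *)
have mX D b : D b -> measurable_fun
    [set: g_sigma_algebraType (cylinders X D)]
    (X b : g_sigma_algebraType (cylinders X D) -> R).
  move=> Db _ C mC; rewrite setTI; apply: sub_sigma_algebra.
  exact: cylinder_preimage.
apply: (@probability_blocks_indep _ _ _ _ _ X _ past next).
- exact: noise_independent.
- apply/seteqP; split=> // b []; rewrite /past /next /= => + bn.
  by rewrite bn lerD2l lez_nat ltnn.
- have : measurable_fun [set: g_sigma_algebraType (cylinders X past)]
      (wall_field s n a : g_sigma_algebraType (cylinders X past) -> surface R d).
    apply: measurable_to_surface => i.
    apply: (@measurable_wall R d p p_jump _
      (g_sigma_algebraType (cylinders X past)) (fun m j => X (s + m, j)) n (a + i)).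
    move=> m j mn.
    by apply: mX; rewrite /past /= lerD2l lez_nat.
  by move=> /(_ measurableT _ mA); rewrite setTI.
- have : measurable_fun [set: g_sigma_algebraType (cylinders X next)]
      (noise_field eps (s + n.+1%:Z) a :
         g_sigma_algebraType (cylinders X next) -> surface R d).
    apply: measurable_to_surface => i.
    by apply: (mX next (s + n.+1%:Z, a + i)).
  by move=> /(_ measurableT _ mB); rewrite setTI.
Qed.

Lemma ge0_integral_wall_noise s n a
    (phi : surface R d * surface R d -> \bar R) :
  measurable_fun setT phi -> (forall z, 0 <= phi z)%E ->
  (\int[P]_t phi (wall_field s n a t, noise_field eps (s + n.+1%:Z) a t) =
   \int[P]_t \int[noise_law eps]_e phi (wall_field s n a t, e))%E.
Proof.
apply: ge0_integral_indep_pair.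
- exact: measurable_wall_field.
- exact: measurable_noise_field.
- exact: wall_noise_indep.
- by move=> B mB; exact: noise_fieldE.
Qed.

Lemma measurable_wall_step_pair : measurable_fun setT
  (fun z : surface R d * surface R d => wall_step p z.1 z.2 : surface R d).
Proof.
apply: measurable_to_surface => i; apply: (measurable_wall_step p_jump) => j.
  by apply: (measurableT_comp (measurable_coordinate j)).
by apply: (measurableT_comp (measurable_coordinate j)).
Qed.

Lemma wall_kernel_ge0 f : (forall w, 0 <= f w)%E ->
  forall w, (0 <= wall_kernel f w)%E.
Proof. by move=> f0 w; apply: integral_ge0 => e _. Qed.

Lemma measurable_wall_kernel f : measurable_fun setT f ->
  (forall w, 0 <= f w)%E -> measurable_fun setT (wall_kernel f).
Proof.
move=> mf f0.
pose phi (z : surface R d * surface R d) := f (wall_step p z.1 z.2 : surface R d).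
have mphi : measurable_fun setT phi.
  exact: measurableT_comp mf measurable_wall_step_pair.
have := @measurable_fun_fubini_tonelli_F _ _ _ _ _ (noise_law eps) phi mphi.
by apply=> z; exact: f0.
Qed.

Lemma iter_wall_kernel_ge0 f n : (forall w, 0 <= f w)%E ->
  forall w, (0 <= iter n wall_kernel f w)%E.
Proof. by move=> f0; elim: n => //= n IH; exact: wall_kernel_ge0. Qed.

Lemma measurable_iter_wall_kernel f n : measurable_fun setT f ->
  (forall w, 0 <= f w)%E -> measurable_fun setT (iter n wall_kernel f).
Proof.
move=> mf f0; elim: n => //= n IH; apply: measurable_wall_kernel => //.
exact: iter_wall_kernel_ge0.
Qed.

(* The right-hand side depends neither on s nor on a: the process is
   stationary under translations of space and of the starting time. *)
Lemma wall_field_law s n a f : measurable_fun setT f ->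
  (forall w, 0 <= f w)%E ->
  (\int[P]_t f (wall_field s n a t) =
   iter n wall_kernel f ((fun=> 0%R) : surface R d))%E.
Proof.
elim: n f => [|n IH] f mf f0.
  transitivity (\int[P]_t (cst (f (fun=> 0%R)) t))%E.
    by apply: eq_integral => t _; congr f; apply/funext.
  rewrite integral_cst //=; apply: etrans (mule1 _).
  by congr (_ * _)%E; exact: probability_setT.
transitivity (\int[P]_t wall_kernel f (wall_field s n a t))%E; last first.
  rewrite iterSr IH //; first exact: measurable_wall_kernel.
  exact: wall_kernel_ge0.
rewrite -(ge0_integral_wall_noise s n a
  (phi := fun z => f (wall_step p z.1 z.2 : surface R d))) //.
  by apply: eq_integral => t _; rewrite wall_fieldS.
exact: measurableT_comp mf measurable_wall_step_pair.
Qed.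

End wall_law.

(** * Reflections *)

Section wall_means.
Variables (disp : measure_display) (T : measurableType disp) (R : realType).
Variables (P : probability T R) (d : nat) (p : Zd d -> R).
Variable eps : int -> Zd d -> {RV P >-> R}.
Hypothesis p_jump : jump_law p.
Hypothesis eps_noise : iid_symmetric_noise eps.

Local Notation W := (wall_from p eps).
Local Notation K := (wall_kernel p eps).

Lemma wall_field_stationary s n a f : measurable_fun setT f ->
  (forall w, 0 <= f w)%E ->
  (\int[P]_t f (wall_field p eps s n a t) =
   \int[P]_t f (wall_field p eps 0 n 0 t))%E.
Proof. by move=> mf f0; rewrite !(wall_field_law p_jump). Qed.

Lemma wall_from_stationary s n i (f : R -> \bar R) : measurable_fun setT f ->
  (forall x, 0 <= f x)%E ->
  (\int[P]_t f (W s n i t) = \int[P]_t f (W 0 n 0 t))%E.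
Proof.
move=> mf f0.
have mfc : measurable_fun setT (fun w : surface R d => f (coordinate 0 w)).
  by apply: measurableT_comp => //; exact: measurable_coordinate.
have /= := wall_field_stationary s n i mfc (fun w => f0 _).
by rewrite /wall_field /coordinate !addr0.
Qed.

Definition mean_wall n : \bar R := (\int[P]_t (W 0 n 0 t)%:E)%E.

Lemma integral_wall_from s n i : (\int[P]_t (W s n i t)%:E = mean_wall n)%E.
Proof.
(* Stationarity is stated for functions nonnegative on all of [R]; the absolute value agrees with
   the identity on the values of the wall. *)
have absE s' i' : (\int[P]_t (W s' n i' t)%:E = \int[P]_t `|W s' n i' t|%:E)%E.
  by apply: eq_integral => t _; rewrite ger0_norm // wall_from_ge0.
rewrite /mean_wall !absE.
apply: (@wall_from_stationary s n i (fun x => `|x|%:E)) => [|x].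
  by apply/measurable_EFinP; exact: normr_measurable.
by rewrite lee_fin.
Qed.

Lemma integral_averaging (X : T -> Zd d -> R) (c : \bar R) i : (0 <= c)%E ->
  (forall j, measurable_fun setT (fun t => X t j)) ->
  (forall t j, 0 <= X t j) -> (forall j, \int[P]_t (X t j)%:E = c)%E ->
  (\int[P]_t (averaging p (X t) i)%:E = c)%E.
Proof.
move=> c0 mX X0 Xc; under eq_integral do rewrite (averagingE p_jump) -sumEFin.
rewrite ge0_integral_sum //; last 2 first.
- move=> k; apply/measurable_EFinP/measurable_funM => //; exact: mX.
- by move=> k t _; rewrite lee_fin mulr_ge0 // jump_ge0.
under eq_bigr => k _.
  under eq_integral do rewrite EFinM.
  rewrite ge0_integralZl ?lee_fin ?jump_ge0 //; last first.
  - by move=> t _; rewrite lee_fin.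
  - by apply/measurable_EFinP; exact: mX.
  rewrite Xc; over.
rewrite -ge0_sume_distrl => [|k _]; last by rewrite lee_fin jump_ge0.
by rewrite sumEFin jump_support_total // mul1e.
Qed.

Definition reflection s n i t : R :=
  Num.max (- (averaging p (fun j => W s n j t) i + eps (s + n.+1%:Z) i t)) 0.

Lemma reflection_ge0 s n i t : 0 <= reflection s n i t.
Proof. by rewrite le_max lexx orbT. Qed.

Lemma wall_from_reflection s n i t : W s n.+1 i t =
  averaging p (fun j => W s n j t) i + eps (s + n.+1%:Z) i t +
  reflection s n i t.
Proof.
rewrite wall_fromS /reflection; set x := _ + _.
by case: (lerP 0 x) => x0; rewrite ?addr0 //; case: (lerP 0 (- x)) => ?; lra.
Qed.

Lemma measurable_reflection s n i : measurable_fun setT (reflection s n i).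
Proof.
apply: measurable_maxr => //; apply: measurable_funN; apply: measurable_funD.
  by apply: (measurable_averaging p_jump) => j; exact: measurable_wall_from.
exact: measurable_funPT.
Qed.

(** The conditional expectation of the next reflection at the origin, given that the present surface
    is [w]. *)
Definition reflection_cost (w : surface R d) : \bar R :=
  (\int[noise_law eps]_e
     (Num.max (- (averaging p w 0 + (e : Zd d -> R) 0)) 0)%:E)%E.

Let cost_pair (z : surface R d * surface R d) : \bar R :=
  (Num.max (- (averaging p z.1 0 + (z.2 : Zd d -> R) 0)) 0)%:E.

Let measurable_cost_pair : measurable_fun setT cost_pair.
Proof.
apply/measurable_EFinP; apply: measurable_maxr => //.
apply: measurable_funN; apply: measurable_funD.
  apply: (measurable_averaging p_jump) => j.
  by apply: (measurableT_comp (measurable_coordinate j)).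
by apply: (measurableT_comp (measurable_coordinate 0)).
Qed.

Let cost_pair_ge0 z : (0 <= cost_pair z)%E.
Proof. by rewrite lee_fin le_max lexx orbT. Qed.

Lemma reflection_cost_ge0 w : (0 <= reflection_cost w)%E.
Proof. by apply: integral_ge0 => e _; exact: (cost_pair_ge0 (w, e)). Qed.

Lemma measurable_reflection_cost : measurable_fun setT reflection_cost.
Proof.
have := @measurable_fun_fubini_tonelli_F _ _ _ _ _ (noise_law eps) cost_pair
  measurable_cost_pair.
by apply=> z; exact: cost_pair_ge0.
Qed.

(** Conditioning on the wall before the step replaces the reflection by its cost, whose mean is an
    iterate of the kernel at the flat surface, whatever [s] and [i]. *)
Lemma integral_reflection s n i : (\int[P]_t (reflection s n i t)%:E =
  iter n K reflection_cost ((fun=> 0%R) : surface R d))%E.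
Proof.
rewrite -(wall_field_law p_jump eps_noise s n i measurable_reflection_cost
  reflection_cost_ge0).
rewrite -(ge0_integral_wall_noise p_jump eps_noise s n i measurable_cost_pair
  cost_pair_ge0).
apply: eq_integral => t _; rewrite /cost_pair /reflection /=.
rewrite (averaging_shift p_jump (fun j => W s n j t)) addr0.
by rewrite /noise_field addr0.
Qed.

Definition antitone (f : surface R d -> \bar R) :=
  forall w w' : surface R d,
    (forall i, (w : Zd d -> R) i <= (w' : Zd d -> R) i) -> (f w' <= f w)%E.

Lemma le_wall_step (w w' e : Zd d -> R) i : (forall j, w j <= w' j) ->
  wall_step p w e i <= wall_step p w' e i.
Proof.
move=> ww'; rewrite /wall_step ge_max [X in _ && X]le_max lexx orbT andbT.
by rewrite le_max lerD2r le_averaging.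
Qed.

Lemma measurable_wall_kernel_integrand (f : surface R d -> \bar R) (w : surface R d) :
  measurable_fun setT f ->
  measurable_fun setT (fun e : surface R d => f (wall_step p w e : surface R d)).
Proof.
move=> mf; apply: (measurableT_comp mf); apply: measurable_to_surface => i.
apply: (measurable_wall_step p_jump) => j; first exact: measurable_cst.
exact: measurable_coordinate.
Qed.

Lemma antitone_wall_kernel (f : surface R d -> \bar R) : measurable_fun setT f ->
  (forall w, 0 <= f w)%E -> antitone f -> antitone (K f).
Proof.
move=> mf f0 af w w' ww'; apply: ge0_le_integral => //.
- exact: measurable_wall_kernel_integrand.
- exact: measurable_wall_kernel_integrand.
- by move=> e _; apply: af => i; exact: le_wall_step.
Qed.

Lemma antitone_iter_wall_kernel (f : surface R d -> \bar R) n : measurable_fun setT f ->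
  (forall w, 0 <= f w)%E -> antitone f -> antitone (iter n K f).
Proof.
move=> mf f0 af; elim: n => //= n IH; apply: antitone_wall_kernel => //.
  exact: measurable_iter_wall_kernel.
exact: iter_wall_kernel_ge0.
Qed.

(** One step from the flat surface leads to a surface above it, and the iterates of the kernel keep
    [f] antitone. The outer step is therefore compared with the constant value at the flat
    surface. *)
Lemma iter_wall_kernel0_noninc (f : surface R d -> \bar R) n : measurable_fun setT f ->
  (forall w, 0 <= f w)%E -> antitone f ->
  (iter n.+1 K f ((fun=> 0%R) : surface R d) <=
   iter n K f ((fun=> 0%R) : surface R d))%E.
Proof.
move=> mf f0 af; rewrite iterS /wall_kernel.
set g := iter n K f; pose c := g (fun=> 0).
have g0 : forall w, (0 <= g w)%E by exact: iter_wall_kernel_ge0.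
have -> : g (fun=> 0) = (\int[noise_law eps]_e cst c e)%E.
  rewrite integral_cst //=; apply/esym; apply: etrans (mule1 _).
  by congr (_ * _)%E; exact: probability_setT.
apply: ge0_le_integral => //.
- apply: measurable_wall_kernel_integrand.
  exact: measurable_iter_wall_kernel.
- move=> e _; apply: antitone_iter_wall_kernel => // i.
  by rewrite le_max lexx orbT.
Qed.

Lemma antitone_reflection_cost : antitone reflection_cost.
Proof.
move=> w w' ww'; apply: ge0_le_integral => //.
- by move=> e _; exact: (cost_pair_ge0 (w', e)).
- exact: (measurableT_comp measurable_cost_pair (measurable_pair1 w')).
- exact: (measurableT_comp measurable_cost_pair (measurable_pair1 w)).
- move=> e _; rewrite lee_fin ge_max [X in _ && X]le_max lexx orbT andbT.
  by rewrite le_max lerN2 lerD2r le_averaging.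
Qed.

Definition mean_reflection n : \bar R := (\int[P]_t (reflection 0 n 0 t)%:E)%E.

Lemma mean_reflection_ge0 n : (0 <= mean_reflection n)%E.
Proof. by apply: integral_ge0 => t _; rewrite lee_fin reflection_ge0. Qed.

Lemma integral_reflectionE s n i :
  (\int[P]_t (reflection s n i t)%:E = mean_reflection n)%E.
Proof. by rewrite /mean_reflection !integral_reflection. Qed.

Lemma mean_reflection_noninc n : (mean_reflection n.+1 <= mean_reflection n)%E.
Proof.
rewrite /mean_reflection !integral_reflection; apply: iter_wall_kernel0_noninc.
- exact: measurable_reflection_cost.
- exact: reflection_cost_ge0.
- exact: antitone_reflection_cost.
Qed.

Lemma mean_wall_ge0 n : (0 <= mean_wall n)%E.
Proof. by apply: integral_ge0 => t _; rewrite lee_fin wall_from_ge0. Qed.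

(** Averaging preserves the mean, by stationarity in space, and the noise is centered, by symmetry;
    only the reflection contributes. *)
Lemma mean_wallS n : mean_wall n.+1 = (mean_wall n + mean_reflection n)%E.
Proof.
pose e : {RV P >-> R} := eps (0 + n.+1%:Z) 0.
pose pos (x : R) := (Num.max x 0)%:E; pose neg (x : R) := (Num.max (- x) 0)%:E.
have mpos : measurable_fun setT pos.
  by apply/measurable_EFinP; apply: measurable_maxr.
have mneg : measurable_fun setT neg.
  by apply/measurable_EFinP; apply: measurable_maxr => //; exact: measurable_oppr.
have pos0 x : (0 <= pos x)%E by rewrite lee_fin le_max lexx orbT.
have neg0 x : (0 <= neg x)%E by rewrite lee_fin le_max lexx orbT.
have mpe : measurable_fun setT (fun t => pos (e t)).
  by apply: measurableT_comp => //; exact: measurable_funPT.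
have mne : measurable_fun setT (fun t => neg (e t)).
  by apply: measurableT_comp => //; exact: measurable_funPT.
have pn : (\int[P]_t pos (e t) = \int[P]_t neg (e t))%E.
  by rewrite -(ge0_integral_noise_sym eps_noise (0 + n.+1%:Z) 0 mpos pos0).
have nfin : (\int[P]_t neg (e t))%E \is a fin_num.
  rewrite ge0_fin_numE; last by apply: integral_ge0.
  have /integrableP[me] := noise_integrable eps_noise (0 + n.+1%:Z) 0.
  apply: le_lt_trans; apply: ge0_le_integral => //.
    exact: measurableT_comp.
  move=> t _; rewrite /neg /= lee_fin ge_max normr_ge0 andbT.
  by rewrite -normrN ler_norm.
have mA : measurable_fun setT (fun t => (averaging p (fun j => W 0 n j t) 0)%:E).
  apply/measurable_EFinP; apply: (measurable_averaging p_jump) => j.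
  exact: measurable_wall_from.
have A0 t : (0 <= (averaging p (fun j => W 0 n j t) 0)%:E)%E.
  by rewrite lee_fin averaging_ge0 // => j; exact: wall_from_ge0.
have mr : measurable_fun setT (fun t => (reflection 0 n 0 t)%:E).
  by apply/measurable_EFinP; exact: measurable_reflection.
have EA : (\int[P]_t (averaging p (fun j => W 0 n j t) 0)%:E = mean_wall n)%E.
  apply: (integral_averaging (X := fun t j => W 0 n j t)).
  - exact: mean_wall_ge0.
  - by move=> j; exact: measurable_wall_from.
  - by move=> t j; exact: wall_from_ge0.
  - by move=> j; exact: integral_wall_from.
(* Both sides are integrals of nonnegative functions; the two noise integrals
   are equal by symmetry and finite, hence cancel. *)
have : (mean_wall n.+1 + \int[P]_t neg (e t) =
    mean_wall n + mean_reflection n + \int[P]_t pos (e t))%E.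
  rewrite -EA /mean_reflection -!ge0_integralD //.
  - apply: eq_integral => t _; rewrite -!EFinD wall_from_reflection -/e.
    by congr EFin; case: (lerP 0 (e t)) => ?; case: (lerP 0 (- e t)) => ?; lra.
  - by move=> t _; rewrite adde_ge0 // lee_fin reflection_ge0.
  - exact: emeasurable_funD.
  - by move=> t _; rewrite lee_fin reflection_ge0.
  - by move=> t _; rewrite lee_fin wall_from_ge0.
  - by apply/measurable_EFinP; exact: measurable_wall_from.
by rewrite pn => /(congr1 (fun x => x - \int[P]_t neg (e t)))%E; rewrite !addeK.
Qed.

End wall_means.

(** * Sublinear growth *)

Section soft_abs.
Variables (R : realType) (L : R).
Hypothesis L_gt0 : 0 < L.

(** A smooth convex majorant of the absolute value whose curvature is at most [1 / L], so that small
    symmetric noise raises it little. *)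
Definition soft_abs (x : R) : R := Num.sqrt (L ^+ 2 + x ^+ 2).

Lemma sqr_soft_abs x : soft_abs x ^+ 2 = L ^+ 2 + x ^+ 2.
Proof. by rewrite sqr_sqrtr // addr_ge0 // sqr_ge0. Qed.

Lemma soft_abs_ge0 x : 0 <= soft_abs x. Proof. exact: sqrtr_ge0. Qed.

Lemma soft_abs0 : soft_abs 0 = L.
Proof. by rewrite /soft_abs expr0n addr0 sqrtr_sqr gtr0_norm. Qed.

Lemma le_soft_abs x y : `|x| <= `|y| -> soft_abs x <= soft_abs y.
Proof.
by move=> xy; rewrite ler_wsqrtr // lerD2l -(ger0_norm (sqr_ge0 x))
  -(ger0_norm (sqr_ge0 y)) !normrX ler_pXn2r // nnegrE.
Qed.

Lemma soft_abs_geL x : L <= soft_abs x.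
Proof. by rewrite -[leLHS]soft_abs0 le_soft_abs // normr0. Qed.

Lemma norm_le_soft_abs x : `|x| <= soft_abs x.
Proof.
rewrite -(ler_pXn2r (n := 2)) ?nnegrE ?soft_abs_ge0 //.
by rewrite sqr_soft_abs real_normK ?num_real // lerDr sqr_ge0.
Qed.

(** After multiplication by [soft_abs x], this is the Cauchy-Schwarz inequality for the vectors
    [(L, x)] and [(L, y)]. *)
Lemma soft_abs_tangent x y :
  soft_abs x + x / soft_abs x * (y - x) <= soft_abs y.
Proof.
have := sqr_soft_abs x; have := sqr_soft_abs y.
have := soft_abs_geL x; have := soft_abs_geL y.
set s := soft_abs x; set r := soft_abs y => rL sL r2 s2.
have s0 : 0 < s by apply: lt_le_trans sL.
rewrite -(ler_pM2l s0).
have -> : s * (s + x / s * (y - x)) = s ^+ 2 + x * (y - x).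
  by field; rewrite gt_eqF.
rewrite s2 (_ : _ + _ = L ^+ 2 + x * y); last by ring.
have r0 : 0 < r by apply: lt_le_trans rL.
have [|xy] := lerP (L ^+ 2 + x * y) 0.
  by move/le_trans; apply; rewrite mulr_ge0 // ltW.
have sr0 : 0 <= s * r by rewrite mulr_ge0 // ltW.
rewrite -(ler_pXn2r (n := 2)) ?nnegrE ?(ltW xy) //.
rewrite exprMn s2 r2 -subr_ge0 (_ : _ - _ = (L * (x - y)) ^+ 2) ?sqr_ge0 //.
by ring.
Qed.

Definition soft_gain (e : R) : R := Num.min `|e| (e ^+ 2 / (2 * L)).

Lemma soft_gain_ge0 e : 0 <= soft_gain e.
Proof.
by rewrite le_min normr_ge0 divr_ge0 ?sqr_ge0 // mulr_ge0 // ltW.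
Qed.

(** The bound by [|e|] is the Lipschitz property. For the quadratic bound, [(u + v)^2 <= 2 (u^2 +
    v^2) = 4 s^2 + 4 e^2], and with [q = e^2 / (2 L)] and [L <= s] this is at most
    [(2 (s + q))^2]. *)
Lemma soft_abs_spread x e :
  soft_abs (x + e) + soft_abs (x - e) <= 2 * (soft_abs x + soft_gain e).
Proof.
have lip z : soft_abs (x + z) <= soft_abs x + `|z|.
  rewrite -(ler_pXn2r (n := 2)) ?nnegrE ?addr_ge0 ?soft_abs_ge0 //.
  have xz : x * z <= soft_abs x * `|z|.
    by rewrite (le_trans (ler_norm _)) // normrM ler_wpM2r // norm_le_soft_abs.
  rewrite sqr_soft_abs !sqrrD sqr_soft_abs real_normK ?num_real //.
  by move: xz; lra.
rewrite /soft_gain; case: (leP `|e| (e ^+ 2 / (2 * L))) => _.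
  have := lip e; have := lip (- e); rewrite normrN; lra.
have := sqr_soft_abs x; have := sqr_soft_abs (x + e).
have := sqr_soft_abs (x - e); have := soft_abs_geL x.
have := soft_abs_ge0 (x + e); have := soft_abs_ge0 (x - e).
set s := soft_abs x; set u := soft_abs (x + e); set v := soft_abs (x - e).
move=> v0 u0 sL v2 u2 s2.
have s0 : 0 <= s by apply: le_trans sL; exact: ltW.
pose q := e ^+ 2 / (2 * L).
have q0 : 0 <= q by rewrite divr_ge0 ?sqr_ge0 // mulr_ge0 // ltW.
have qL : e ^+ 2 = 2 * L * q by rewrite /q mulrC divfK // gt_eqF // mulr_gt0.
rewrite -/q -(ler_pXn2r (n := 2)) ?nnegrE ?addr_ge0 ?mulr_ge0 ?addr_ge0 //.
have uv : (u + v) ^+ 2 <= 2 * (u ^+ 2 + v ^+ 2).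
  by have := sqr_ge0 (u - v); lra.
apply: le_trans uv _; rewrite u2 v2.
have : L * q <= s * q by rewrite ler_wpM2r.
have := sqr_ge0 q.
rewrite (_ : (2 * (s + q)) ^+ 2 = 4 * s ^+ 2 + 8 * (s * q) + 4 * q ^+ 2).
  by rewrite s2; move: qL; lra.
by ring.
Qed.

Lemma measurable_soft_abs : measurable_fun setT soft_abs.
Proof.
apply: continuous_measurable_fun => x; apply: continuous_comp.
  by apply: continuousD; [exact: cst_continuous|exact: exprn_continuous].
exact: sqrt_continuous.
Qed.

Lemma measurable_soft_gain : measurable_fun setT soft_gain.
Proof.
apply: measurable_minr; first exact: normr_measurable.
by apply: measurable_funM => //; apply: measurable_funX.
Qed.

End soft_abs.

Section sublinear_growth.
Variables (disp : measure_display) (T : measurableType disp) (R : realType).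
Variables (P : probability T R) (d : nat) (p : Zd d -> R).
Variable eps : int -> Zd d -> {RV P >-> R}.
Hypothesis p_jump : jump_law p.
Hypothesis eps_noise : iid_symmetric_noise eps.

Local Notation W := (wall_from p eps).

(** Jensen's inequality: the tangent at the average lies below the potential, and its linear term
    averages to zero. *)
Lemma soft_abs_averaging (L : R) (w : Zd d -> R) i : 0 < L ->
  soft_abs L (averaging p w i) <= averaging p (fun j => soft_abs L (w j)) i.
Proof.
move=> L0; set x := averaging p w i.
apply: le_trans (le_averaging p_jump i (fun j => soft_abs_tangent L0 x (w j))).
rewrite averagingD // averaging_cst // averagingE //.
under eq_bigr do rewrite mulrCA.
rewrite -mulr_sumr -(averagingE p_jump (fun j => w j - x)) averagingB // averaging_cst //.
by rewrite subrr mulr0 addr0.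
Qed.

Definition noise_gain (L : R) : \bar R :=
  (\int[P]_t (soft_gain L (eps 0 0 t))%:E)%E.

Lemma integral_soft_abs_noise L k i x : 0 < L ->
  (\int[P]_t (soft_abs L (x + eps k i t))%:E <=
   (soft_abs L x)%:E + noise_gain L)%E.
Proof.
move=> L0.
have mS (c : R) : measurable_fun setT (fun y : R => (soft_abs L (x + c * y))%:E).
  apply/measurable_EFinP; apply: measurableT_comp (measurable_soft_abs L) _.
  by apply: measurable_funD => //; exact: measurable_funM.
have mE (c : R) : measurable_fun setT (fun t : T => (soft_abs L (x + c * eps k i t))%:E).
  by apply: (measurableT_comp (mS c)); exact: measurable_funPT.
have mG : measurable_fun setT (EFin \o soft_gain L).
  by apply/measurable_EFinP; exact: measurable_soft_gain.
have mGE : measurable_fun setT (fun t => (soft_gain L (eps k i t))%:E).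
  by apply: (measurableT_comp mG); exact: measurable_funPT.
have G0 (y : R) : (0 <= (soft_gain L y)%:E)%E by rewrite lee_fin soft_gain_ge0.
have S0 (y : R) : (0 <= (soft_abs L y)%:E)%E by rewrite lee_fin soft_abs_ge0.
have gainE : noise_gain L = (\int[P]_t (soft_gain L (eps k i t))%:E)%E.
  rewrite /noise_gain -(ge0_integral_noise_site eps_noise 0 0 0 mG) //.
  by rewrite (ge0_integral_noise_site eps_noise k 0 i mG).
set A := (X in (X <= _)%E).
have A1 : A = (\int[P]_t (soft_abs L (x + 1 * eps k i t))%:E)%E.
  by apply: eq_integral => t _; rewrite mul1r.
(* By symmetry the integral is unchanged when the noise changes sign; adding both forms makes the
   pointwise bound on [x + e] and [x - e] applicable. *)
have AN : A = (\int[P]_t (soft_abs L (x + (-1) * eps k i t))%:E)%E.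
  rewrite A1 -(ge0_integral_noise_sym eps_noise k i (mS 1) (fun y => S0 _)).
  by apply: eq_integral => t _; rewrite mul1r mulN1r.
have : (A + A <= 2%:E * ((soft_abs L x)%:E + noise_gain L))%E.
  rewrite [X in (X + _)%E]A1 [X in (_ + X)%E]AN -ge0_integralD // gainE.
  have -> : (soft_abs L x)%:E = (\int[P]_t cst (soft_abs L x)%:E t)%E.
    rewrite integral_cst //; apply/esym; apply: etrans (mule1 _).
    by congr (_ * _)%E; exact: probability_setT.
  rewrite -ge0_integralD //; last by move=> t _; exact: S0.
  rewrite -ge0_integralZl //; last 2 first.
  - by apply: emeasurable_funD.
  - by move=> t _; apply: adde_ge0; [exact: S0|exact: G0].
  apply: ge0_le_integral => //.
  - by move=> t _; rewrite adde_ge0.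
  - by apply: emeasurable_funD; exact: mE.
  - by apply: measurable_funeM; apply: emeasurable_funD.
  - move=> t _; rewrite /= -EFinD -EFinD -EFinM lee_fin mul1r mulN1r.
    exact: soft_abs_spread.
have -> : (A + A = 2%:E * A)%E by rewrite mule_natl mule2n.
by rewrite lee_pmul2l.
Qed.

Lemma integral_soft_abs_wall L n : 0 < L ->
  (\int[P]_t (soft_abs L (W 0 n.+1 0 t))%:E <=
   \int[P]_t (soft_abs L (W 0 n 0 t))%:E + noise_gain L)%E.
Proof.
move=> L0.
have mSoft : measurable_fun setT (EFin \o soft_abs L).
  by apply/measurable_EFinP; exact: measurable_soft_abs.
have S0 (y : R) : (0 <= (soft_abs L y)%:E)%E by rewrite lee_fin soft_abs_ge0.
have gain0 : (0 <= noise_gain L)%E.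
  by apply: integral_ge0 => t _; rewrite lee_fin soft_gain_ge0.
pose phi (z : surface R d * surface R d) : \bar R :=
  (soft_abs L (averaging p z.1 0 + (z.2 : Zd d -> R) 0))%:E.
have mphi : measurable_fun setT phi.
  apply: measurableT_comp mSoft _; apply: measurable_funD.
    apply: (measurable_averaging p_jump) => j.
    by apply: (measurableT_comp (measurable_coordinate j)).
  by apply: (measurableT_comp (measurable_coordinate 0)).
pose A (t : T) := averaging p (fun j => W 0 n j t) 0.
have mA : measurable_fun setT A.
  by apply: (measurable_averaging p_jump) => j; exact: measurable_wall_from.
have mSW m j : measurable_fun setT (fun t => soft_abs L (W 0 m j t)).
  by apply: measurableT_comp (measurable_soft_abs L) _; exact: measurable_wall_from.
have AE t : averaging p (wall_field p eps 0 n 0 t) 0 = A t.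
  by congr averaging; apply/funext => j; rewrite /wall_field add0r.
(* Taking the positive part does not increase the absolute value, hence not the potential either. *)
apply: (@le_trans _ _ (\int[P]_t phi (wall_field p eps 0 n 0 t,
    noise_field eps (0 + n.+1%:Z) 0 t))%E).
  apply: ge0_le_integral => //.
  - exact/measurable_EFinP.
  - apply: measurableT_comp mphi _; apply: measurable_fun_pair.
      exact: measurable_wall_field.
    exact: measurable_noise_field.
  move=> t _; rewrite /phi lee_fin /= AE /noise_field addr0 wall_fromS.
  apply: le_soft_abs; rewrite ger0_norm ?le_max ?lexx ?orbT //.
  by rewrite ge_max ler_norm normr_ge0.
rewrite (ge0_integral_wall_noise p_jump eps_noise) //; last by move=> z; exact: S0.
(* With the surface frozen, integrating over the independent layer costs at most [noise_gain L]. *)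
apply: (@le_trans _ _ (\int[P]_t ((soft_abs L (A t))%:E + noise_gain L))%E).
  apply: ge0_le_integral => //.
  - by move=> t _; apply: integral_ge0 => e _; exact: S0.
  - have := @measurable_fun_fubini_tonelli_F _ _ _ _ _ (noise_law eps) phi mphi.
    move=> /(_ (fun z => S0 _)) mF; apply: measurableT_comp mF _.
    exact: measurable_wall_field.
  - apply: emeasurable_funD => //; exact: measurableT_comp mSoft mA.
  move=> t _; rewrite /phi /= AE.
  pose f (y : R) := (soft_abs L (A t + y))%:E.
  have mf : measurable_fun setT f.
    apply: measurableT_comp mSoft _; exact: measurable_funD.
  rewrite (ge0_integral_noise_site eps_noise 0 0 0 mf (fun y => S0 _)).
  exact: (integral_soft_abs_noise 0 0).
rewrite ge0_integralD //; last exact: measurableT_comp mSoft mA.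
have -> : (\int[P]_t noise_gain L = noise_gain L)%E.
  rewrite (integral_cst P measurableT); apply: etrans (mule1 _).
  by congr (_ * _)%E; exact: probability_setT.
apply: leeD2r.
(* By stationarity all sites have the same mean potential, so averaging over sites keeps it;
   Jensen's inequality then concludes. *)
have <- : (\int[P]_t (averaging p (fun j => soft_abs L (W 0 n j t)) 0)%:E =
    \int[P]_t (soft_abs L (W 0 n 0 t))%:E)%E.
  apply: (@integral_averaging _ _ _ P _ _ p_jump
    (fun t j => soft_abs L (W 0 n j t))) => //.
  - by apply: integral_ge0 => t _.
  - by move=> t j; exact: soft_abs_ge0.
  - by move=> j; exact: (wall_from_stationary p_jump eps_noise 0 n j mSoft).
apply: ge0_le_integral => //.
- exact: measurableT_comp mSoft mA.
- by apply/measurable_EFinP; exact: (measurable_averaging p_jump).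
- by move=> t _; rewrite lee_fin soft_abs_averaging.
Qed.

Lemma noise_gain_lt_pinfty L : 0 < L -> (noise_gain L < +oo)%E.
Proof.
move=> L0; have /integrableP[me] := noise_integrable eps_noise 0 0.
apply: le_lt_trans; apply: ge0_le_integral => //.
- by move=> t _; rewrite lee_fin soft_gain_ge0.
- apply/measurable_EFinP; apply: measurableT_comp (measurable_soft_gain L) _.
  exact: measurable_funPT.
- exact: measurableT_comp.
- by move=> t _; rewrite lee_fin /soft_gain ge_min lexx.
Qed.

Lemma noise_gain_ge0 L : 0 < L -> (0 <= noise_gain L)%E.
Proof.
by move=> L0; apply: integral_ge0 => t _; rewrite lee_fin soft_gain_ge0.
Qed.

(** Dominated convergence along [L = k + 1]: the gain is at most the integrable [|eps|] and tends to
    zero pointwise like [1 / L]. *)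
Lemma noise_gain_vanish (delta : R) : 0 < delta ->
  exists2 L : R, 0 < L & (noise_gain L <= delta%:E)%E.
Proof.
move=> delta0.
pose f (k : nat) t := (soft_gain k.+1%:R (eps 0 0 t))%:E.
have mf k : measurable_fun setT (f k).
  apply/measurable_EFinP; apply: measurableT_comp (measurable_soft_gain _) _.
  exact: measurable_funPT.
have cf t : (f ^~ t) @ \oo --> (0%E : \bar R).
  apply/fine_cvgP; split; first by near=> k.
  apply: (@squeeze_cvgr _ _ _ _ (cst 0)
    (fun k => (eps 0 0 t) ^+ 2 / 2 * (k.+1%:R)^-1)).
  - near=> k; rewrite /= soft_gain_ge0 // /soft_gain ge_min invfM mulrA lexx.
    by rewrite orbT.
  - exact: cvg_cst.
  - rewrite -[X in _ --> X](mulr0 ((eps 0 0 t) ^+ 2 / 2)).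
    by apply: cvgMr; exact: cvg_harmonic.
have ie := noise_integrable eps_noise 0 0.
have mc : measurable_fun setT (cst 0%E : T -> \bar R) by exact: measurable_cst.
have cfae : {ae P, forall t, setT t -> (f ^~ t) @ \oo --> (0%E : \bar R)}.
  by apply: aeW => t _; exact: cf.
have dom : {ae P, forall t k, setT t -> (`|f k t| <= `|(eps 0 0 t)%:E|)%E}.
  apply: aeW => t k _; rewrite /f gee0_abs ?lee_fin ?soft_gain_ge0 //.
  by rewrite /soft_gain ge_min lexx.
have [_ _] := dominated_convergence measurableT mf mc cfae (integrable_abse ie) dom.
rewrite integral0 => /fine_cvgP[_ /cvgrPdist_le /(_ _ delta0)] [N _ NP].
exists N.+1%:R => //; have := NP N (leqnn N).
have fin : noise_gain N.+1%:R \is a fin_num.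
  by rewrite ge0_fin_numE ?noise_gain_lt_pinfty ?noise_gain_ge0.
rewrite sub0r normrN /= => /(le_trans (ler_norm _)).
by rewrite -lee_fin fineK.
Unshelve. all: by end_near.
Qed.

(** The potential dominates the wall, equals [L] at time zero, and its mean grows by at most
    [noise_gain L] per step. *)
Lemma mean_wall_le (L : R) n : 0 < L ->
  (mean_wall p eps n <= L%:E + n%:R%:E * noise_gain L)%E.
Proof.
move=> L0; apply: (@le_trans _ _ (\int[P]_t (soft_abs L (W 0 n 0 t))%:E)%E).
  apply: ge0_le_integral => //.
  - by move=> t _; rewrite lee_fin wall_from_ge0.
  - by apply/measurable_EFinP; exact: measurable_wall_from.
  - apply/measurable_EFinP; apply: measurableT_comp (measurable_soft_abs L) _.
    exact: measurable_wall_from.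
  - move=> t _; rewrite lee_fin (le_trans (ler_norm _)) //.
    exact: norm_le_soft_abs.
elim: n => [|n IH].
  rewrite mul0e adde0 (_ : (fun _ => _) = cst L%:E); last first.
    by apply/funext => t; rewrite /= /wall_from /= soft_abs0.
  rewrite integral_cst // [X in (_ * X)%E](_ : _ = 1%E) ?mule1 //.
  exact: probability_setT.
apply: le_trans (integral_soft_abs_wall n L0) _.
apply: (le_trans (leeD2r _ IH)); rewrite -addeA.
by rewrite -natr1 EFinD ge0_muleDl ?lee_fin // mul1e.
Qed.

End sublinear_growth.

(** * Divergence in probability *)

Lemma measurable_sublevel (disp : measure_display) (T : measurableType disp)
    (R : realType) (f : T -> R) (c : R) :
  measurable_fun setT f -> measurable [set t | f t <= c].
Proof.
move=> mf; have := mf measurableT `]-oo, c]%classic (measurable_itv _).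
by rewrite setTI; congr (measurable _); apply/seteqP; split=> t /=; rewrite in_itv.
Qed.

Lemma measurable_superlevel (disp : measure_display) (T : measurableType disp)
    (R : realType) (f : T -> R) (c : R) :
  measurable_fun setT f -> measurable [set t | c <= f t].
Proof.
move=> mf; have := mf measurableT `[c, +oo[%classic (measurable_itv _).
rewrite setTI; congr (measurable _); apply/seteqP.
by split=> t /=; rewrite in_itv /= andbT.
Qed.

Lemma le_probability_markov (disp : measure_display) (T : measurableType disp)
    (R : realType) (P : probability T R) (f : T -> R) (c : R) :
  measurable_fun setT f -> (forall t, 0 <= f t) -> 0 <= c ->
  (c%:E * P [set t | (c <= f t)%R] <= \int[P]_t (f t)%:E)%E.
Proof.
move=> mf f0 c0; set D := [set t | c <= f t].
have mD : measurable D by exact: measurable_superlevel.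
have mfE : measurable_fun setT (EFin \o f) by exact/measurable_EFinP.
have <- : (\int[P]_(t in D) (cst c%:E) t = c%:E * P D)%E by rewrite integral_cst.
apply: (@le_trans _ _ (\int[P]_(t in D) (f t)%:E)%E).
  apply: ge0_le_integral => //.
  exact: measurable_funS mfE.
apply: ge0_subset_integral => // t _; exact: f0.
Qed.

(** * Vanishing of the mean reflection, and iterated averages *)

Section escape.
Variables (disp : measure_display) (T : measurableType disp) (R : realType).
Variables (P : probability T R) (d : nat) (p : Zd d -> R).
Variable eps : int -> Zd d -> {RV P >-> R}.
Hypothesis p_jump : jump_law p.
Hypothesis eps_noise : iid_symmetric_noise eps.

Local Notation W := (wall_from p eps).
Local Notation A m := (iter m (averaging p)).

Lemma mean_wall_fin n : mean_wall p eps n \is a fin_num.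
Proof.
rewrite ge0_fin_numE ?mean_wall_ge0 //.
apply: le_lt_trans (mean_wall_le p_jump eps_noise n ltr01) _.
rewrite lte_add_pinfty ?ltry // lte_mul_pinfty ?lee_fin //.
exact: noise_gain_lt_pinfty.
Qed.

Lemma mean_wall_sublinear (delta : R) : 0 < delta ->
  \forall n \near \oo, (mean_wall p eps n <= (delta * n%:R)%:E)%E.
Proof.
move=> delta0; have delta20 : 0 < delta / 2 by rewrite divr_gt0.
have [L L0 gainL] := noise_gain_vanish eps_noise delta20.
near=> n; apply: (le_trans (mean_wall_le p_jump eps_noise n L0)).
apply: (@le_trans _ _ (L%:E + n%:R%:E * (delta / 2)%:E)%E).
  by rewrite leeD2l // lee_wpmul2l // lee_fin.
rewrite -EFinM -EFinD lee_fin.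
have : L <= delta / 2 * n%:R.
  rewrite mulrC -ler_pdivrMr //.
  by near: n; exact: nbhs_infty_ger.
by lra.
Unshelve. all: by end_near.
Qed.

(** The mean wall at time [n] is the sum of the first [n] mean reflections, each at least the one at
    time [m] by monotonicity. *)
Lemma mean_reflection_le n m : (n <= m)%N ->
  (n%:R%:E * mean_reflection p eps m <= mean_wall p eps n)%E.
Proof.
elim: n => [|n IH] nm; first by rewrite mul0e mean_wall_ge0.
rewrite -natr1 EFinD ge0_muleDl ?lee_fin // mul1e (mean_wallS p_jump eps_noise).
apply: leeD; first by apply: IH; exact: ltnW.
rewrite -(subnKC (ltnW nm)); elim: (m - n)%N => [|k IHk]; first by rewrite addn0.
by rewrite addnS (le_trans _ IHk) // mean_reflection_noninc.
Qed.

Lemma mean_reflection_vanish (delta : R) : 0 < delta ->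
  \forall n \near \oo, (mean_reflection p eps n <= delta%:E)%E.
Proof.
move=> delta0; near=> n.
have n0 : (0 < n)%N by near: n; exact: nbhs_infty_gt.
have nR : 0 < n%:R :> R by rewrite ltr0n.
rewrite -(@lee_pmul2l _ n%:R%:E) ?lte_fin //.
apply: (le_trans (mean_reflection_le (leqnn n))).
rewrite -EFinM mulrC; near: n; exact: mean_wall_sublinear.
Unshelve. all: by end_near.
Qed.

Lemma iter_averagingD m f g i :
  A m (fun j => f j + g j) i = A m f i + A m g i.
Proof.
elim: m i => //= m IH i; rewrite -(averagingD p_jump).
by congr averaging; apply/funext.
Qed.

Lemma iter_averaging_ge0 m f i : (forall j, 0 <= f j) -> 0 <= A m f i.
Proof. by move=> f0; elim: m i => //= m IH i; exact: averaging_ge0. Qed.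

Lemma measurable_iter_averaging (disp' : measure_display)
    (T' : measurableType disp') m (X : T' -> Zd d -> R) i :
  (forall j, measurable_fun setT (fun t => X t j)) ->
  measurable_fun setT (fun t => A m (X t) i).
Proof.
by move=> mX; elim: m i => //= m IH i; exact: (measurable_averaging p_jump).
Qed.

Lemma integral_iter_averaging m (X : T -> Zd d -> R) (c : \bar R) i :
  (0 <= c)%E -> (forall j, measurable_fun setT (fun t => X t j)) ->
  (forall t j, 0 <= X t j) -> (forall j, \int[P]_t (X t j)%:E = c)%E ->
  (\int[P]_t (A m (X t) i)%:E = c)%E.
Proof.
move=> c0 mX X0 Xc; elim: m i => //= m IH i.
apply: (integral_averaging p_jump (X := fun t => A m (X t))) => //.
  by move=> j; exact: measurable_iter_averaging.
by move=> t j; exact: iter_averaging_ge0.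
Qed.

(** Finite range makes an iterated average a convex combination over finitely many sites, chosen
    before [f]. *)
Lemma iter_averaging_local m (c : R) i : exists s : seq (Zd d),
  forall f, (forall j, j \in s -> f j <= c) -> A m f i <= c.
Proof.
elim: m i => [|m IH] i; first by exists [:: i] => f; apply; rewrite inE.
have [s sP] := choice IH.
exists (flatten [seq s (i + k) | k <- jump_support p]) => f fc.
rewrite iterS (averagingE p_jump) -(averaging_cst p_jump c i).
rewrite (averagingE p_jump) big_seq [leRHS]big_seq; apply: ler_sum => k kS.
rewrite ler_wpM2l ?jump_ge0 //; apply: sP => j js; apply: fc.
by apply/flattenP; exists (s (i + k)) => //; exact: map_f.
Qed.

(** It suffices that the noise is at most [- a] at finitely many sites, an event whose probability
    is a finite product of positive factors. *)
Lemma noise_law_low_gt0 (a : R) m i :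
  (0 < P [set t | (eps 0 0 t <= - a)%R])%E ->
  (0 < noise_law eps [set e : surface R d | (A m e i <= - a)%R])%E.
Proof.
move=> q0; have [s sP] := iter_averaging_local m (- a) i.
pose B (j : Zd d) : set R := `]-oo, (- a)]%classic.
have mB j : measurable (B j) by exact: measurable_itv.
have BE j x : B j x = (x <= - a) by rewrite /B /= in_itv.
have mcap : measurable (\bigcap_(j in [set` undup s]) coordinate j @^-1` B j).
  apply: fin_bigcap_measurable => // j _; rewrite -[X in measurable X]setTI.
  exact: measurable_coordinate.
have mA : measurable [set e : surface R d | A m e i <= - a].
  apply: measurable_sublevel; apply: measurable_iter_averaging => j.
  exact: measurable_coordinate.
apply: (@lt_le_trans _ _
  (noise_law eps (\bigcap_(j in [set` undup s]) coordinate j @^-1` B j))).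
  rewrite -(noise_fieldE eps_noise 0 0) // noise_field_cylinder ?undup_uniq //.
  apply: (big_ind (fun x : \bar R => (0 < x)%E)) => [|x y|j _] //.
    exact: mule_gt0.
apply: le_measure; rewrite ?inE // => e eB; apply: sP => j js.
by apply: eB; rewrite /= mem_undup.
Qed.

End escape.

(** * Escape of the averaged surface and of the wall *)

Section delocalization.
Variables (disp : measure_display) (T : measurableType disp) (R : realType).
Variables (P : probability T R) (d : nat) (p : Zd d -> R).
Variable eps : int -> Zd d -> {RV P >-> R}.
Hypothesis p_jump : jump_law p.
Hypothesis eps_noise : iid_symmetric_noise eps.

Local Notation W := (wall_from p eps).
Local Notation A m := (iter m (averaging p)).

(** The [m]-fold average of the new surface is the sum of those of [P W_n], the noise and the
    reflection. When the first two are low, which are independent events, the sum is low unless the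
    averaged reflection reaches [delta]; Markov's inequality bounds the latter. *)
Lemma averaged_wall_low_step (a c delta : R) m n i : 0 < delta ->
  (P [set t | (A m.+1 (fun j => W 0 n j t) i <= c)%R] *
   noise_law eps [set e : surface R d | (A m e i <= - a)%R] <=
   P [set t | (A m (fun j => W 0 n.+1 j t) i <= c - a + delta)%R] +
   (delta^-1)%:E * mean_reflection p eps n)%E.
Proof.
move=> delta0.
have mAw k : measurable_fun setT (fun w : surface R d => A k w i).
  by apply: measurable_iter_averaging => // j; exact: measurable_coordinate.
have mAW k s : measurable_fun setT (fun t => A k (fun j => W 0 s j t) i).
  by apply: measurable_iter_averaging => // j; exact: measurable_wall_from.
have mAr : measurable_fun setT (fun t => A m (fun j => reflection p eps 0 n j t) i).
  by apply: measurable_iter_averaging => // j; exact: measurable_reflection.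
have wallE t : wall_field p eps 0 n 0 t = (fun j => W 0 n j t) :> (Zd d -> R).
  by apply/funext => j; rewrite /wall_field add0r.
set D := [set e : surface R d | (A m e i <= - a)%R].
set C := [set w : surface R d | (A m.+1 w i <= c)%R].
have mD : measurable D by exact: measurable_sublevel.
have mC : measurable C by exact: measurable_sublevel.
have -> : [set t | A m.+1 (fun j => W 0 n j t) i <= c] =
    wall_field p eps 0 n 0 @^-1` C.
  by apply/seteqP; split=> t; rewrite /C /preimage /mkset wallE.
rewrite -(noise_fieldE eps_noise (0 + n.+1%:Z) 0 mD).
rewrite -(wall_noise_indep p_jump eps_noise) //.
set E := [set t | _ <= c - a + delta].
pose F := [set t | delta <= A m (fun j => reflection p eps 0 n j t) i].
have mE : measurable E by exact: measurable_sublevel.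
have mF : measurable F by exact: measurable_superlevel.
apply: (@le_trans _ _ (P (E `|` F))).
  apply: le_measure; rewrite ?inE.
  - apply: measurableI; rewrite -[X in measurable X]setTI.
      exact: measurable_wall_field.
    exact: measurable_noise_field.
  - exact: measurableU.
  move=> t []; rewrite /C /D /preimage /mkset wallE => Ct Dt.
  have [Ft|Ft] := leP delta (A m (fun j => reflection p eps 0 n j t) i).
    by right.
  left; rewrite /E /mkset.
  rewrite (_ : (fun j => W 0 n.+1 j t) = fun j =>
      averaging p (fun j => W 0 n j t) j +
        noise_field eps (0 + n.+1%:Z) 0 t j + reflection p eps 0 n j t).
    rewrite !iter_averagingD // -iterSr.
    by move: Ct Dt Ft; lra.
  by apply/funext => j; rewrite wall_from_reflection /noise_field (add0r j).
apply: (le_trans (measureU2 _ mE mF)); rewrite leeD2l //.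
rewrite -(@lee_pmul2l _ delta%:E) ?lte_fin // muleA -EFinM divff ?gt_eqF // mul1e.
have A0 t : 0 <= A m (fun j => reflection p eps 0 n j t) i.
  by apply: iter_averaging_ge0 => // j; exact: reflection_ge0.
apply: (le_trans (le_probability_markov P mAr A0 (ltW delta0))).
rewrite (integral_iter_averaging p_jump m
  (X := fun t j => reflection p eps 0 n j t) (c := mean_reflection p eps n)) //.
- exact: mean_reflection_ge0.
- by move=> j; exact: measurable_reflection.
- by move=> t j; exact: reflection_ge0.
- by move=> j; exact: integral_reflectionE.
Qed.

(** Induction on [m]: a low layer of fixed probability [q] trades one averaging for a drop of nearly
    [a] in the threshold. For [m = 0] the threshold is negative, and the wall is never that low. *)
Lemma averaged_wall_escape (a c delta : R) m i : 0 < a ->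
  (0 < P [set t | (eps 0 0 t <= - a)%R])%E ->
  c < a * m%:R -> 0 < delta ->
  \forall n \near \oo,
    (P [set t | (A m (fun j => W 0 n j t) i <= c)%R] <= delta%:E)%E.
Proof.
move=> a0 q0; elim: m c delta => [|m IH] c delta cam delta0.
  near=> n; rewrite (_ : [set t | _] = set0) ?measure0 ?lee_fin ?ltW //.
  apply/seteqP; split=> // t /=; apply/negP; rewrite -ltNge.
  by apply: lt_le_trans (wall_from_ge0 _ _ _ _ _ _); rewrite mulr0 in cam.
set q := noise_law eps [set e : surface R d | (A m e i <= - a)%R].
have q0' : (0 < q)%E by exact: noise_law_low_gt0.
have qfin : q \is a fin_num.
  rewrite fin_num_measure //; apply: measurable_sublevel.
  by apply: measurable_iter_averaging => // j; exact: measurable_coordinate.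
have qE : q = (fine q)%:E by rewrite fineK.
have fq0 : 0 < fine q by rewrite -lte_fin -qE.
(* Half of the available slack, so that [c - a + g] still lies below [a * m]. *)
pose g := (a * m.+1%:R - c) / 2.
have g0 : 0 < g by rewrite divr_gt0 // subr_gt0.
have cg : c - a + g < a * m%:R by rewrite /g -natr1; move: cam; rewrite -natr1; lra.
(* The induction hypothesis and the reflection term contribute [eta] each, in total [delta * q]; the
   factor [q] then cancels. *)
pose eta := delta * fine q / 2.
have eta0 : 0 < eta by rewrite divr_gt0 // mulr_gt0.
have low := IH _ _ cg eta0.
have geta0 : 0 < g * eta by rewrite mulr_gt0.
near=> n; rewrite -(@lee_pmul2r _ q) //.
  apply: (le_trans (averaged_wall_low_step a c m n i g0)).
  have -> : (delta%:E * q = eta%:E + (g^-1)%:E * (g * eta)%:E)%E.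
    rewrite qE -!EFinM -EFinD mulrA mulVf ?gt_eqF // mul1r /eta.
    by congr EFin; lra.
  apply: leeD.
    (* The induction hypothesis is needed at time [n + 1]. *)
    near: n; have [N _ NP] := low; exists N => // k /= Nk.
    by apply: NP; exact: leqW.
  rewrite lee_wpmul2l ?lee_fin ?invr_ge0 ?(ltW g0) //.
  by near: n; exact: mean_reflection_vanish.
Unshelve. all: by end_near.
Qed.

(* The displacement V of step 4. *)
Fixpoint pushed s m (i : Zd d) (t : T) : R :=
  if m is m'.+1 then
    averaging p (fun j => pushed s m' j t) i + reflection p eps s m' i t
  else 0.

Lemma pushed_ge0 s m i t : 0 <= pushed s m i t.
Proof.
elim: m i => //= m IH i.
by rewrite addr_ge0 ?reflection_ge0 // averaging_ge0.
Qed.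

Lemma measurable_pushed s m i : measurable_fun setT (pushed s m i).
Proof.
elim: m i => //= m IH i; apply: measurable_funD.
  exact: measurable_averaging.
exact: measurable_reflection.
Qed.

(** In mean, the displacement starts at zero and gains one mean reflection per step, exactly like
    the mean wall. *)
Lemma integral_pushed s m i :
  (\int[P]_t (pushed s m i t)%:E = mean_wall p eps m)%E.
Proof.
elim: m i => [|m IH] i.
  by rewrite /mean_wall; apply: eq_integral.
rewrite (mean_wallS p_jump eps_noise) -(integral_reflectionE p_jump eps_noise s m i).
rewrite -(integral_averaging p_jump i (mean_wall_ge0 p eps m)
  (measurable_pushed s m) (fun t j => pushed_ge0 s m j t) IH).
rewrite -ge0_integralD //.
- by move=> t _; rewrite lee_fin averaging_ge0 // => j; exact: pushed_ge0.
- apply/measurable_EFinP; apply: measurable_averaging => // j.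
  exact: measurable_pushed.
- by move=> t _; rewrite lee_fin reflection_ge0.
- by apply/measurable_EFinP; exact: measurable_reflection.
Qed.

(** Both walls receive the same noise after time [n]. In the induction step the positive part on the
    right is bounded below by its argument, while the reflection of the restarted wall cancels
    against the one added to [pushed]. *)
Lemma wall_from_split n m i t :
  A m (fun j => W 0 n j t) i + W n%:Z m i t - pushed n%:Z m i t <=
  W 0 (n + m)%N i t.
Proof.
elim: m i => [|m IH] i; first by rewrite /= addn0 /wall_from /= addr0 subr0.
rewrite addnS [leRHS]wall_fromS le_max; apply/orP; left.
rewrite wall_from_reflection /=.
have -> : 0 + (n + m).+1%:Z = n%:Z + m.+1%:Z by rewrite add0r -addnS PoszD.
have := le_averaging p_jump i IH.
by rewrite averagingB // averagingD //; lra.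
Qed.

Lemma wall_low_vanish (a M delta : R) i : 0 < a ->
  (0 < P [set t | (eps 0 0 t <= - a)%R])%E -> 0 < delta ->
  \forall n \near \oo, (P [set t | (W 0 n i t <= M)%R] <= delta%:E)%E.
Proof.
move=> a0 q0 delta0.
have a40 : 0 < a / 4 by rewrite divr_gt0.
(* The first bound makes [a m / 4] dominate [M]; the second makes Markov's inequality for [pushed]
   at level [a m / 4] cost at most [delta / 2]. *)
have [m mM mbound] : exists2 m : nat, 4 * `|M| / a + 1 <= m%:R :> R &
    (mean_wall p eps m <= (delta / 2 * (a / 4) * m%:R)%:E)%E.
  near \oo => m; exists m; near: m; first exact: nbhs_infty_ger.
  by apply: mean_wall_sublinear => //; rewrite mulr_gt0 // divr_gt0.
have m0 : 0 < m%:R :> R.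
  by apply: lt_le_trans mM; rewrite ltr_wpDl // divr_ge0 ?mulr_ge0 // ltW.
(* Below the escape level [a m], yet above [M] by at least [a m / 4]: a wall below [M] thus requires
   a low average or a large displacement. *)
pose c := a * m%:R / 2.
have cam : c < a * m%:R by have : 0 < a * m%:R; [rewrite mulr_gt0|rewrite /c; lra].
have cM : a / 4 * m%:R <= c - M.
  have : 4 * `|M| / a * a <= m%:R * a.
    by rewrite ler_wpM2r ?(ltW a0) //; move: mM; lra.
  rewrite divfK ?gt_eqF //; have := ler_norm M; rewrite /c; lra.
have [N _ NP] : \forall n \near \oo,
    (P [set t | (A m (fun j => W 0 n j t) i <= c)%R] <= (delta / 2)%:E)%E.
  by apply: averaged_wall_escape q0 cam _; rewrite // divr_gt0.
exists (N + m)%N => // n /= nN.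
rewrite -(@subnK m n); last exact: leq_trans (leq_addl _ _) nN.
set k := (n - m)%N; have kN : (N <= k)%N by rewrite -(addnK m N) leq_sub2r.
set E := [set t | A m (fun j => W 0 k j t) i <= c].
set F := [set t | a / 4 * m%:R <= pushed k%:Z m i t].
have mE : measurable E.
  apply: measurable_sublevel; apply: measurable_iter_averaging => // j.
  exact: measurable_wall_from.
have mF : measurable F.
  by apply: measurable_superlevel; exact: measurable_pushed.
apply: (@le_trans _ _ (P (E `|` F))).
  apply: le_measure; rewrite ?inE.
  - by apply: measurable_sublevel; exact: measurable_wall_from.
  - exact: measurableU.
  move=> t /= Wt.
  have [Et|Et] := leP (A m (fun j => W 0 k j t) i) c; [by left|right].
  have := wall_from_split k m i t; have := wall_from_ge0 p eps k%:Z m i t.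
  rewrite /F /mkset; move: Wt cM Et; lra.
apply: (le_trans (measureU2 _ mE mF)).
rewrite (splitr delta) EFinD; apply: leeD; first exact: NP.
rewrite -(@lee_pmul2l _ (a / 4 * m%:R)%:E) ?lte_fin ?mulr_gt0 //.
apply: (le_trans (le_probability_markov P (measurable_pushed k%:Z m i)
  (pushed_ge0 k%:Z m i) (ltW (mulr_gt0 a40 m0)))).
rewrite integral_pushed -EFinM; apply: le_trans mbound _.
by rewrite lee_fin; lra.
Unshelve. all: by end_near.
Qed.

End delocalization.

(** * Limits and invariant laws *)

Lemma cvge0_of_vanish (R : realType) (u : nat -> \bar R) :
  (forall n, 0 <= u n)%E ->
  (forall delta : R, 0 < delta -> \forall n \near \oo, (u n <= delta%:E)%E) ->
  u n @[n --> \oo] --> 0%E.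
Proof.
move=> u0 uv; apply/fine_cvgP; split.
  have [N _ NP] := uv 1 ltr01; exists N => // n /NP /= un.
  by rewrite ge0_fin_numE // (le_lt_trans un) ?ltry.
apply/cvgrPdist_le => delta delta0.
have [N _ NP] := uv _ delta0; exists N => // n /NP /= un.
rewrite sub0r normrN ger0_norm ?fine_ge0 // -lee_fin fineK //.
by rewrite ge0_fin_numE // (le_lt_trans un) ?ltry.
Qed.

(** Otherwise [eps <= - 1 / (k + 1)] has probability zero for every [k], so the noise is almost
    surely not negative; by symmetry it is almost surely not positive, hence zero. *)
Lemma symmetric_noise_lower_tail (disp : measure_display)
    (T : measurableType disp) (R : realType) (P : probability T R) (d : nat)
    (eps : int -> Zd d -> {RV P >-> R}) :
  iid_symmetric_noise eps -> P (eps 0 0 @^-1` [set 0]) <> 1%E ->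
  exists2 a : R, 0 < a & (0 < P [set t | (eps 0 0 t <= - a)%R])%E.
Proof.
move=> eps_noise nontrivial; apply: contrapT => no_tail; apply: nontrivial.
have me : measurable_fun setT (eps 0 0) by exact: measurable_funPT.
pose low k := [set t | eps 0 0 t <= - k.+1%:R^-1].
have mlow k : measurable (low k) by exact: measurable_sublevel.
have low0 k : P (low k) = 0%E.
  apply/eqP; rewrite eq_le measure_ge0 andbT leNgt; apply/negP => lowk.
  by apply: no_tail; exists k.+1%:R^-1.
pose neg : set R := [set x | x < 0].
have mneg : measurable neg.
  by rewrite (_ : neg = `]-oo, 0[%classic) //; apply/seteqP; split=> x;
    rewrite /= in_itv.
have mneg' : measurable [set x : R | neg (- x)].
  rewrite (_ : mkset _ = `]0, +oo[%classic) //; apply/seteqP.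
  by split=> x; rewrite /neg /= in_itv /= andbT => ?; lra.
have Pneg : P (eps 0 0 @^-1` neg) = 0%E.
  have : P.-negligible (\bigcup_k low k).
    by apply: negligible_bigcup => k; exists (low k); split=> //; exact: low0.
  move=> /(negligibleP P (bigcupT_measurable _ mlow))/eqP.
  rewrite -measure_le0 => low_le0.
  apply/eqP; rewrite -measure_le0; apply: le_trans low_le0.
  apply: le_measure; rewrite ?inE.
  - by rewrite -[X in measurable X]setTI; exact: me.
  - exact: bigcupT_measurable.
  move=> t /= t0; have /ltr_add_invr[k] : 0 < - eps 0 0 t by rewrite oppr_gt0.
  by rewrite add0r => kt; exists k => //; rewrite /low /= lerNr ltW.
have Ppos : P [set t | neg (- eps 0 0 t)] = 0%E.
  by rewrite -(noise_symmetric eps_noise 0 0 mneg).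
have m0 : measurable (eps 0 0 @^-1` [set 0]).
  by rewrite -[X in measurable X]setTI; exact: me.
have mN : measurable (eps 0 0 @^-1` neg).
  by rewrite -[X in measurable X]setTI; exact: me.
have mP : measurable [set t | neg (- eps 0 0 t)].
  by have := me measurableT _ mneg'; rewrite setTI.
apply/eqP; rewrite eq_le probability_le1 //= -(probability_setT P).
apply: (@le_trans _ _ (P (eps 0 0 @^-1` [set 0] `|`
    (eps 0 0 @^-1` neg `|` [set t | neg (- eps 0 0 t)])))).
  apply: le_measure; rewrite ?inE //; first by do 2 apply: measurableU => //.
  move=> t _; rewrite /neg /=; case: (ltrgtP (eps 0 0 t) 0) => [|e0|->].
  - by right; left.
  - by right; right; rewrite oppr_lt0.
  - by left.
apply: (le_trans (measureU2 _ m0 _)); first exact: measurableU.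
rewrite -[leRHS]adde0; apply: leeD => //.
apply: (le_trans (measureU2 _ mN mP)); rewrite -[leRHS]adde0.
have Pneg_le0 : (P (eps 0%R 0%R @^-1` neg) <= 0)%E by rewrite Pneg.
have Ppos_le0 : (P [set t | neg (- eps 0%R 0%R t)%R] <= 0)%E by rewrite Ppos.
exact: leeD Pneg_le0 Ppos_le0.
Qed.

(** * Comparison of invariant laws with the process started flat *)

Section wall_limits.
Variables (disp : measure_display) (T : measurableType disp) (R : realType).
Variables (P : probability T R) (d : nat) (p : Zd d -> R).
Variable eps : int -> Zd d -> {RV P >-> R}.
Hypothesis p_jump : jump_law p.
Hypothesis eps_noise : iid_symmetric_noise eps.

Lemma wall_processE n i : wall_process p eps n i = wall_from p eps 0 n i.
Proof.
apply/funext => t; rewrite /wall_process /wall_from.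
by congr wall; apply/funext => m; apply/funext => j; rewrite add0r.
Qed.

Lemma wall_meanE n : wall_mean p eps n = mean_wall p eps n.
Proof. by rewrite /wall_mean unlock wall_processE. Qed.

(** Independence of noise and surface turns the distributional fixed-point equation into invariance
    under the kernel. *)
Lemma ge0_integral_wall_invariant (nu : probability (surface R d) R)
    (f : surface R d -> \bar R) : wall_invariant p eps nu ->
  measurable_fun setT f -> (forall w, 0 <= f w)%E ->
  (\int[nu]_w f w = \int[nu]_w wall_kernel p eps f w)%E.
Proof.
move=> [disp' [T' [Q [e [Z [e_law eZ_indep Z_law step_law]]]]]] mf f0.
have mZ : measurable_fun setT Z by exact: measurable_funPT.
have me : measurable_fun setT e by exact: measurable_funPT.
pose step t : surface R d := wall_step p (Z t) (e t).
have mstep : measurable_fun setT step.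
  apply: (measurableT_comp (measurable_wall_step_pair p_jump)
    (g := fun t => (Z t, e t))).
  exact: measurable_fun_pair.
pose step' : {RV Q >-> surface R d} :=
  HB.pack step (isMeasurableFun.Build _ _ _ _ step mstep).
transitivity (\int[distribution Q step']_w f w)%E.
  by apply: eq_measure_integral => A mA _; exact: step_law.
rewrite ge0_integral_distribution //.
transitivity (\int[distribution Q Z]_w wall_kernel p eps f w)%E; last first.
  by apply: eq_measure_integral => A mA _; exact/esym/Z_law.
rewrite ge0_integral_distribution //; last first.
- exact: wall_kernel_ge0.
- exact: measurable_wall_kernel.
pose phi (z : surface R d * surface R d) := f (wall_step p z.1 z.2 : surface R d).
apply: (@ge0_integral_indep_pair _ _ _ _ _ _ _ Q (noise_law eps) Z e phi) => //.
- by move=> A B mA mB; rewrite setIC muleC; exact: eZ_indep.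
- move=> B mB; apply: etrans (e_law B mB) _.
  apply: etrans _ (noise_fieldE eps_noise 0 0 mB).
  congr (P _); apply/seteqP; split=> t; rewrite /preimage /mkset.
    by congr B; apply/funext => i; rewrite /noise_field add0r.
  by congr B; apply/funext => i; rewrite /noise_field add0r.
- exact: measurableT_comp mf (measurable_wall_step_pair p_jump).
- by move=> z; exact: f0.
Qed.

Lemma ge0_integral_wall_invariant_iter (nu : probability (surface R d) R)
    (f : surface R d -> \bar R) n : wall_invariant p eps nu ->
  measurable_fun setT f -> (forall w, 0 <= f w)%E ->
  (\int[nu]_w f w = \int[nu]_w iter n (wall_kernel p eps) f w)%E.
Proof.
move=> nu_inv mf f0; elim: n => //= n ->.
apply: ge0_integral_wall_invariant => //; first exact: measurable_iter_wall_kernel.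
exact: iter_wall_kernel_ge0.
Qed.

(** The indicator of a low value at the origin is antitone, and [nu]-almost every surface lies above
    the flat one. Its [n]-th kernel iterate is thus largest at the flat start, where it is the
    probability on the right. *)
Lemma nondegenerate_low_le (nu : probability (surface R d) R) (M : R) n :
  nondegenerate_law nu -> wall_invariant p eps nu ->
  (nu [set w | ((w : Zd d -> R) 0 <= M)%R] <=
   P [set t | (wall_from p eps 0 n 0 t <= M)%R])%E.
Proof.
move=> nu_nondeg nu_inv.
set B := [set w : surface R d | _].
have mB : measurable B.
  by apply: measurable_sublevel; exact: measurable_coordinate.
pose f (w : surface R d) : \bar R := (\1_B w)%:E.
have mf : measurable_fun setT f.
  by apply/measurable_EFinP; exact: measurable_indic.
have f0 w : (0 <= f w)%E by rewrite lee_fin.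
have af : antitone f.
  move=> w w' ww'; rewrite lee_fin !indicE.
  have [Bw'|] := boolP (w' \in B); last by rewrite ler0n.
  rewrite (_ : w \in B) // inE; move: Bw'; rewrite inE /B /=.
  exact: le_trans.
pose K := wall_kernel p eps.
have -> : nu B = (\int[nu]_w iter n K f w)%E.
  rewrite -ge0_integral_wall_invariant_iter //.
  by rewrite integral_indic // setIT.
have -> : P [set t | wall_from p eps 0 n 0 t <= M] =
    iter n K f ((fun=> 0%R) : surface R d).
  rewrite -(wall_field_law p_jump eps_noise 0 n 0 mf f0).
  rewrite (_ : (fun t => _) = fun t =>
      (\1_[set t | wall_from p eps 0 n 0 t <= M] t)%:E); last first.
    apply/funext => t; rewrite /f !indicE; congr (_%:R%:E); congr nat_of_bool.
    by apply/idP/idP; rewrite !inE /B /= /wall_field addr0.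
  rewrite integral_indic ?setIT //.
  by apply: measurable_sublevel; exact: measurable_wall_from.
set c := iter n K f (fun=> 0).
have -> : c = (\int[nu]_w cst c w)%E.
  rewrite integral_cst //; apply/esym; apply: etrans (mule1 _).
  by congr (_ * _)%E; exact: probability_setT.
pose S := [set z : surface R d | forall i, 0 <= (z : Zd d -> R) i].
(* A countable intersection over codes of sites; a number coding no site contributes [setT]. *)
have mS : measurable S.
  pose Si (k : nat) : set (surface R d) :=
    if unpickle k is Some i then [set z : surface R d | 0 <= (z : Zd d -> R) i]
    else setT.
  rewrite (_ : S = \bigcap_k Si k).
    apply: bigcapT_measurable => k; rewrite /Si; case: unpickle => // i.
    by apply: measurable_superlevel; exact: measurable_coordinate.
  apply/seteqP; split=> z zS; first by move=> k _; rewrite /Si; case: unpickle.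
  by move=> i; have := zS (pickle i) I; rewrite /Si pickleK.
apply: ae_ge0_le_integral => //.
- by move=> w _; exact: iter_wall_kernel_ge0.
- exact: measurable_iter_wall_kernel.
- by move=> w _; exact: iter_wall_kernel_ge0.
exists (~` S); split; first exact: measurableC.
  apply: etrans (probability_setC nu mS) _.
  have -> : nu S = 1%E by exact: nu_nondeg.
  exact: subee.
move=> w /= nle Sw; apply: nle => _.
have aK : antitone (iter n K f) by exact: antitone_iter_wall_kernel.
exact: (aK (fun=> 0) w Sw).
Qed.

Hypothesis eps_nontrivial : P (eps 0 0 @^-1` [set 0]) <> 1%E.

Lemma wall_low_cvg0 i (M : R) :
  P [set t | wall_from p eps 0 n i t <= M] @[n --> \oo] --> 0%E.
Proof.
have [a a0 tail] := symmetric_noise_lower_tail eps_noise eps_nontrivial.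
apply: cvge0_of_vanish => [n|delta delta0]; first exact: measure_ge0.
exact: (wall_low_vanish p_jump eps_noise M i a0 tail delta0).
Qed.

(** Letting [n] tend to infinity in the comparison, [nu] gives no mass to any event [w 0 <= k],
    although these events cover the whole space. *)
Lemma wall_invariant_degenerate (nu : probability (surface R d) R) :
  nondegenerate_law nu -> ~ wall_invariant p eps nu.
Proof.
move=> nu_nondeg nu_inv.
pose B (k : nat) := [set w : surface R d | (w : Zd d -> R) 0 <= k%:R].
have mB k : measurable (B k).
  by apply: measurable_sublevel; exact: measurable_coordinate.
have B0 k : nu (B k) = 0%E.
  apply/eqP; rewrite -measure_le0.
  apply: (cvge_to_ge (wall_low_cvg0 0 k%:R)).
  by apply: nearW => n; exact: nondegenerate_low_le.
have : nu.-negligible (\bigcup_k B k).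
  by apply: negligible_bigcup => k; exists (B k); split=> //; exact: B0.
move=> /(negligibleP nu (bigcupT_measurable _ mB)).
rewrite (_ : \bigcup_k B k = setT).
  move=> nuT; have /eqP := etrans (esym (probability_setT nu)) nuT.
  by rewrite onee_eq0.
apply/seteqP; split=> // w _; exists (Num.truncn (`|(w : Zd d -> R) 0|)).+1 => //.
rewrite /B /=; apply: le_trans (ler_norm _) _.
exact/ltW/truncnS_gt.
Qed.

End wall_limits.

(** * Assembly of the four claims *)

Theorem theorem1p1 (R : realType) (d : nat) (d_gt0 : (0 < d)%N)
    (p : Zd d -> R) (p_jump : jump_law p)
    (disp : measure_display) (T : measurableType disp) (P : probability T R)
    (eps : int -> Zd d -> {RV P >-> R})
    (eps_noise : iid_symmetric_noise eps)
    (eps_nontrivial : P (eps 0 0 @^-1` [set 0]) <> 1%E) :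
  [/\ ~ (exists nu : probability (surface R d) R,
           nondegenerate_law nu /\ wall_invariant p eps nu),
      forall (i : Zd d) (M : R), 0 < M ->
        P [set t | M < wall_process p eps n i t] @[n --> \oo] --> 1%E,
      wall_mean p eps n @[n --> \oo] --> +oo%E &
      (wall_mean p eps n * (n%:R^-1)%:E)%E @[n --> \oo] --> 0%E].
Proof.
have low_cvg0 := wall_low_cvg0 p_jump eps_noise eps_nontrivial.
have mW n i : measurable_fun setT (wall_from p eps 0 n i).
  exact: measurable_wall_from.
have lowC n i M : P [set t | M < wall_process p eps n i t] =
    (1 - P [set t | (wall_from p eps 0 n i t <= M)%R])%E.
  rewrite -probability_setC; last exact: measurable_sublevel.
  congr (P _); apply/seteqP; split=> t; rewrite /setC /mkset wall_processE.
    by rewrite ltNge => /negP.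
  by move/negP; rewrite -ltNge.
have high_cvg1 i M :
    P [set t | M < wall_process p eps n i t] @[n --> \oo] --> 1%E.
  have : (1 - P [set t | (wall_from p eps 0 n i t <= M)%R])%E @[n --> \oo] -->
      (1 - 0)%E by apply: cvgeB => //; exact: cvg_cst.
  by under eq_cvg do rewrite -lowC; rewrite sube0.
split.
- by move=> [nu [nu_nondeg]]; exact: wall_invariant_degenerate.
- by move=> i M _; exact: high_cvg1.
- apply/cvgeyPge => M.
  (* Eventually the wall exceeds [c] with probability at least one half, so Markov's inequality
     bounds its mean below by [c / 2], which is at least [M]. *)
  pose c : R := 2 * `|M| + 1.
  have c0 : 0 < c by rewrite /c ltr_wpDl // mulr_ge0.
  have half : (2^-1%:E < 1 :> \bar R)%E by rewrite lte_fin; lra.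
  near=> n; rewrite wall_meanE.
  have Pn : (2^-1%:E <= P [set t | (c < wall_process p eps n 0 t)%R])%E.
    near: n; have := open_nbhs_nbhs (conj (@open_ereal_gt_ereal R 2^-1%:E) half).
    by move=> /(high_cvg1 0 c)[N _ NP]; exists N => // n /NP; exact: ltW.
  apply: (@le_trans _ _ (c%:E * P [set t | (c <= wall_from p eps 0 n 0 t)%R])%E).
    apply: (@le_trans _ _ (c%:E * 2^-1%:E)%E).
      by rewrite -EFinM lee_fin /c; have := ler_norm M; lra.
    rewrite lee_pmul2l ?lte_fin //; apply: le_trans Pn _.
    apply: le_measure; rewrite ?inE.
    + rewrite (_ : mkset _ = ~` [set t | wall_from p eps 0 n 0 t <= c]).
        by apply: measurableC; exact: measurable_sublevel.
      apply/seteqP; split=> t; rewrite /setC /mkset wall_processE.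
        by rewrite ltNge => /negP.
      by move/negP; rewrite -ltNge.
    + exact: measurable_superlevel.
    + by move=> t; rewrite /mkset wall_processE => /ltW.
  apply: le_probability_markov; [exact: mW| |exact: ltW].
  by move=> t; exact: wall_from_ge0.
- apply: cvge0_of_vanish => [n|delta delta0].
    by rewrite wall_meanE mule_ge0 ?mean_wall_ge0 // lee_fin invr_ge0.
  near=> n; rewrite wall_meanE.
  have n0 : 0 < n%:R :> R by rewrite ltr0n; near: n; exact: nbhs_infty_gt.
  apply: (@le_trans _ _ ((delta * n%:R)%:E * (n%:R^-1)%:E)%E).
    rewrite lee_wpmul2r ?lee_fin ?invr_ge0 //.
    by near: n; exact: mean_wall_sublinear.
  by rewrite -EFinM lee_fin mulfK // gt_eqF.
Unshelve. all: by end_near.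
Qed.
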